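(* Let $X \in \mathbb{R}^{n_1 \times n_2 \times n_3}$ have $\mathrm{rank}_{\mathrm{TT}}(X) = (r_1, r_2)$ with $r_1 \le k_1 \le n_1$, $r_2 \le k_2 \le n_3$, $r_1<n_1$, $r_2<n_3$ and $(r_1, r_2) \ne (k_1, k_2)$, and let $X = X_1 \cdot X_2'' \cdot X_3'' = X_1' \cdot X_2' \cdot X_3$ be two tensor-train decompositions of $X$ with factors of sizes $n_1\times r_1$, $r_1\times n_2\times r_2$, $r_2\times n_3$ such that $(X_2''^{\mathrm{L}})^\top \in \mathrm{St}(r_1, n_2 r_2)$, $X_3''^\top \in \mathrm{St}(r_2, n_3)$, $X_1' \in \mathrm{St}(r_1, n_1)$, $X_2'^{\mathrm{R}} \in \mathrm{St}(r_2, r_1 n_2)$. Let $s_i := k_i - r_i$ for $i\in\{1,2\}$. For every $Y \in \mathbb{R}^{n_1 \times n_2 \times n_3}$, every $\varepsilon > 0$ and every integer $i_{\max} \ge 1$, let $(U_1, V_3)$ be any output of the alternating-SVD algorithm described in the context, applied to $Y$, $X$, $s_1$, $s_2$, $\varepsilon$, $i_{\max}$, and let $$\tilde Y := W_1 \cdot X_2''\cdot X_3'' + X_1' \cdot X_2' \cdot W_3 + X_1' \cdot W_2 \cdot X_3'' + U_1 \cdot V_2 \cdot X_3'' + X_1' \cdot U_2 \cdot V_3 + U_1 \cdot Z_2 \cdot V_3,$$ where \begin{align*} W_1 &= P_{X_1'}^\perp ( Y \cdot X_3''^\top )^{\mathrm{L}} ( X_2''^{\mathrm{L}} )^\top, &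 W_3 &= (X_2'^{\mathrm{R}})^\top ( X_1'^\top \cdot Y )^{\mathrm{R}} P_{X_3''^\top}^\perp,\\ U_2 &= \big[ P_{X_2'^{\mathrm{R}}}^\perp ( X_1'^\top \cdot Y )^{\mathrm{R}} \big]^{r_1 \times n_2 \times n_3} \cdot V_3^\top, & W_2 &= X_1'^\top \cdot Y \cdot X_3''^\top, \\ V_2 &= U_1^\top \cdot \big[ ( Y \cdot X_3''^\top )^{\mathrm{L}} P_{( X_2''^{\mathrm{L}})^\top}^\perp\big]^{n_1 \times n_2 \times r_2}, & Z_2 &= U_1^\top \cdot Y \cdot V_3^\top . \end{align*} Then $\tilde Y \in T_X \mathbb{R}_{\le (k_1, k_2)}^{n_1 \times n_2 \times n_3}$ and, with $$\omega := \sqrt{\max\left\{\frac{k_1-r_1}{n_1-r_1}, \frac{k_2-r_2}{n_3-r_2}\right\}},$$ for every $\hat Y \in \mathcal{P}_{T_X \mathbb{R}_{\le (k_1, k_2)}^{n_1 \times n_2 \times n_3}} Y$ one has $$\langle Y, \tilde{Y} \rangle \ge \omega\, \|\hat Y\|\, \|\tilde{Y}\|.$$ (That is, the set-valued map sending $Y$ to the set of all such $\tilde Y$ is an approximate projection onto the tangent cone satisfying the angle condition with constant $\omega$, for all $\varepsilon$ and all $i_{\max}$.)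
   Context: Norms and inner products. $\langle A, B\rangle$ is the sum of products of corresponding entries (Frobenius inner product) and $\|\cdot\|$ the induced norm, for matrices and tensors. Stiefel manifold and projections. $\mathrm{St}(p,n) := \{U \in \mathbb{R}^{n\times p} \mid U^\top U = I_p\}$; for $U \in \mathrm{St}(p,n)$, $P_U := UU^\top$ and $P_U^\perp := I_n - P_U$. Unfoldings and contraction. For $T\in\mathbb{R}^{a\times b\times c}$, $T^{\mathrm{L}} := \mathrm{reshape}(T, a\times bc)$ and $T^{\mathrm{R}} := \mathrm{reshape}(T, ab\times c)$ (column-major ordering, first index fastest); $[\,\cdot\,]^{a\times b\times c}$ denotes reshaping back to a tensor. The symbol $\cdot$ denotes contraction of the last index of the left factor with the first index of the right factor; so $A\cdot T = [A\,T^{\mathrm{L}}]^{a'\times b\times c}$ for $A\in\mathbb{R}^{a'\times a}$, and $T\cdot B = [T^{\mathrm{R}}B]^{a\times b\times c'}$ for $B\in\mathbb{R}^{c\times c'}$. $\otimes$ is the Kronecker product. TT-rank. A tensor-train decomposition (TTD) of $X$ is a factorization $X = X_1\cdot X_2\cdot X_3$ with $X_1\in\mathbb{R}^{n_1\times r_1}$, $X_2\in\mathbb{R}^{r_1\times n_2\times r_2}$, $X_3\in\mathbb{R}^{r_2\times n_3}$; $\mathrm{rank}_{\mathrm{TT}}(X)$ is the minimal $(r_1,r_2)$ for which one exists, and equals $(\mathrm{rank}(X^{\mathrm{L}}),\mathrm{rank}(X^{\mathrm{R}}))$. $\mathbb{R}_{\le (k_1, k_2)}^{n_1 \times n_2 \times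 n_3} := \{X \in \mathbb{R}^{n_1 \times n_2 \times n_3} \mid \mathrm{rank}_{\mathrm{TT}}(X) \le (k_1, k_2)\}$ (componentwise inequality). Tangent cone and projection. $T_X \mathbb{R}_{\le (k_1, k_2)}^{n_1 \times n_2 \times n_3}$ is the (Bouligand) tangent cone at $X$: the set of all limits of sequences $(X_i - X)/t_i$ with $t_i>0$, $t_i\to 0$, $X_i\in \mathbb{R}_{\le (k_1, k_2)}^{n_1 \times n_2 \times n_3}$, $X_i\to X$. It is a closed cone. $\mathcal{P}_{T_X \mathbb{R}_{\le (k_1, k_2)}^{n_1 \times n_2 \times n_3}} Y := \mathrm{argmin}_{Z \in T_X \mathbb{R}_{\le (k_1, k_2)}^{n_1 \times n_2 \times n_3}} \|Z-Y\|^2$ (a nonempty set, all of whose elements have the same norm). Algorithm. ''$[U,S,V]\gets \mathrm{SVD}_s(A)$'' means that $USV^\top$ is a truncated SVD of rank $s$ of $A$ ($U,V$ have $s$ orthonormal columns which are left/right singular vectors for the $s$ largest singular values, $S$ is the diagonal matrix of these); any valid choice is allowed, except that if $A$ has rank less than $s$, singular vectors for the zero singular value are chosen so that the outputs satisfy $U_1^\top X_1' = 0$ and $V_3X_3''^\top=0$. If $s_i = 0$ the corresponding matrix ($U_1$ or $V_3$) is empty. For given $U_1$, $V_3$, write $$A(V_3) := P_{X_1'}^\perp \Big( ( Y \cdot P_{V_3^\top} )^{\mathrm{L}} + ( Y \cdot X_3''^\top )^{\mathrm{L}} P_{(X_2''^{\mathrm{L}})^\top}^\perp ( X_3'' \otimes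 I_{n_2} ) \Big)\in\mathbb{R}^{n_1\times n_2n_3},$$ $$B(U_1) := \Big( ( P_{U_1} \cdot Y )^{\mathrm{R}} + ( I_{n_2} \otimes X_1' ) P_{X_2'^{\mathrm{R}}}^\perp ( X_1'^\top \cdot Y )^{\mathrm{R}} \Big) P_{X_3''^\top}^\perp\in\mathbb{R}^{n_1n_2\times n_3}.$$ Initialize $i\gets 0$, $V_3\gets P_{X_3''^\top}^\perp$, $U_1\gets P_{X_1'}^\perp$ (so that initially $P_{V_3^\top} := V_3^\top V_3 = P_{X_3''^\top}^\perp$ and $P_{U_1} := U_1U_1^\top = P_{X_1'}^\perp$), $\eta_1\gets 0$, $\eta_{\mathrm{new}}\gets\infty$. Case $s_2/(n_3-r_2) > s_1/(n_1-r_1)$: while $i<i_{\max}$ and $|\eta_{\mathrm{new}}-\eta_1|>\varepsilon$ do: $\eta_1\gets\eta_{\mathrm{new}}$, $i\gets i+1$; $[U_1,\sim,\sim]\gets\mathrm{SVD}_{s_1}(A(V_3))$; then $[\sim,S,V_3^\top]\gets\mathrm{SVD}_{s_2}(B(U_1))$; then $\eta_{\mathrm{new}}\gets\|S\|^2+\| P_{U_1} ( Y \cdot X_3''^\top )^{\mathrm{L}} P_{(X_2''^{\mathrm{L}})^\top}^\perp ( X_3'' \otimes I_{n_2} ) \|^2$. Otherwise: while $i<i_{\max}$ and $|\eta_{\mathrm{new}}-\eta_1|>\varepsilon$ do: $\eta_1\gets\eta_{\mathrm{new}}$, $i\gets i+1$; $[\sim,\sim,V_3^\top]\gets\mathrm{SVD}_{s_2}(B(U_1))$;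 then $[U_1,S,\sim]\gets\mathrm{SVD}_{s_1}(A(V_3))$; then $\eta_{\mathrm{new}}\gets\|S\|^2+\| ( I_{n_2} \otimes X_1' ) P_{X_2'^{\mathrm{R}}}^\perp ( X_1'^\top \cdot Y )^{\mathrm{R}} P_{V_3^\top} \|^2$. Output: $U_1, V_3$. (Convention: the comparison with $\infty$ in the first pass, where $\eta_{\mathrm{new}}=\infty$, always passes, as does the second one, since $\eta_1=\infty$.) *)

(* Defs.v *)
From HB Require Import structures.
From mathcomp Require Import all_boot all_order all_algebra.
From mathcomp Require Import boolp classical_sets reals ereal topology normedtype
  sequences.
From mathcomp.real_closed Require Import mxtens.

Set Implicit Arguments.
Unset Strict Implicit.
Unset Printing Implicit Defensive.

Import Order.TTheory GRing.Theory Num.Theory.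
Import numFieldNormedType.Exports.

Local Open Scope classical_set_scope.
Local Open Scope ring_scope.

Definition tensor (R : Type) (a b c : nat) := {ffun 'I_a * 'I_b * 'I_c -> R}.

(* Column-major unfoldings.  [mxtens_index (k, j) : 'I_(c * b)] has value
   [k * b + j], i.e. [j] runs fastest; hence the dimensions are written [c * b]
   and [b * a] (not [b * c] and [a * b]).  The Kronecker product [*t] orders its
   indices in the same way. *)
Section Unfoldings.
Context {R : Type} {a b c : nat}.

Definition unfoldL (T : tensor R a b c) : 'M[R]_(a, c * b) :=
  \matrix_(i, l) T (i, (mxtens_unindex l).2, (mxtens_unindex l).1).

Definition unfoldR (T : tensor R a b c) : 'M[R]_(b * a, c) :=
  \matrix_(l, k) T ((mxtens_unindex l).2, (mxtens_unindex l).1, k).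

Definition foldL (M : 'M[R]_(a, c * b)) : tensor R a b c :=
  [ffun p => M p.1.1 (mxtens_index (p.2, p.1.2))].

Definition foldR (M : 'M[R]_(b * a, c)) : tensor R a b c :=
  [ffun p => M (mxtens_index (p.1.2, p.1.1)) p.2].

End Unfoldings.

Definition contrL {R : pzRingType} {a' a b c : nat}
    (A : 'M[R]_(a', a)) (T : tensor R a b c) : tensor R a' b c :=
  foldL (A *m unfoldL T).

Definition contrR {R : pzRingType} {a b c c' : nat}
    (T : tensor R a b c) (B : 'M[R]_(c, c')) : tensor R a b c' :=
  foldR (unfoldR T *m B).

Notation "A *L T" := (contrL A T) (at level 40, left associativity).
Notation "T *R B" := (contrR T B) (at level 40, left associativity).

Section Norms.
Context {R : realType}.

Definition mxfrob {m n : nat} (A : 'M[R]_(m, n)) : R :=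
  Num.sqrt (\sum_i \sum_j A i j ^+ 2).

Definition tdot {a b c : nat} (S T : tensor R a b c) : R := \sum_p S p * T p.

Definition tnorm {a b c : nat} (T : tensor R a b c) : R := Num.sqrt (tdot T T).

End Norms.

Definition stiefel {R : pzRingType} (p n : nat) : set 'M[R]_(n, p) :=
  [set U | U^T *m U = 1%:M].

(* Defined for every matrix [U], since the algorithm starts from a [U] which has
   no orthonormal columns. *)
Definition Pj {R : pzRingType} {n p : nat} (U : 'M[R]_(n, p)) : 'M[R]_n :=
  U *m U^T.

Definition Pperp {R : pzRingType} {n p : nat} (U : 'M[R]_(n, p)) : 'M[R]_n :=
  1%:M - Pj U.

Section TTRank.
Context {R : pzRingType} {n1 n2 n3 : nat}.

Definition is_ttd (X : tensor R n1 n2 n3) (r1 r2 : nat) (X1 : 'M[R]_(n1, r1))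
    (X2 : tensor R r1 n2 r2) (X3 : 'M[R]_(r2, n3)) : Prop :=
  X = X1 *L X2 *R X3.

Definition has_ttd (X : tensor R n1 n2 n3) (r1 r2 : nat) : Prop :=
  exists X1 X2 X3, @is_ttd X r1 r2 X1 X2 X3.

Definition is_ttrank (X : tensor R n1 n2 n3) (r1 r2 : nat) : Prop :=
  has_ttd X r1 r2 /\
  forall q1 q2, has_ttd X q1 q2 -> (r1 <= q1)%N /\ (r2 <= q2)%N.

Definition ttvariety (k1 k2 : nat) : set (tensor R n1 n2 n3) :=
  [set X | exists r1 r2, [/\ is_ttrank X r1 r2, (r1 <= k1)%N & (r2 <= k2)%N]].

End TTRank.

Section TangentCone.
Context {R : realType} {a b c : nat}.

Definition tensor_cvg (u : nat -> tensor R a b c) (T : tensor R a b c) : Prop :=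
  (fun i => tnorm (u i - T)) @ \oo --> (0 : R).

Definition tangent_cone (M : set (tensor R a b c)) (X : tensor R a b c) :
    set (tensor R a b c) :=
  [set Z | exists (u : nat -> tensor R a b c) (t : nat -> R),
    [/\ forall i, 0 < t i, t @ \oo --> (0 : R), forall i, M (u i),
        tensor_cvg u X & tensor_cvg (fun i => (t i)^-1 *: (u i - X)) Z]].

Definition metric_projection (C : set (tensor R a b c)) (Y : tensor R a b c) :
    set (tensor R a b c) :=
  [set Z | C Z /\ forall Z', C Z' -> tnorm (Z - Y) ^+ 2 <= tnorm (Z' - Y) ^+ 2].

End TangentCone.

(* [U *m S *m V^T] is a truncated SVD of rank [s] of [A]: the leading part of an
   SVD of [A], whose trailing part consists of [t] singular triples [Uc, dc, Vc].
   No order is imposed inside the two groups of singular values. *)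
Definition truncated_svd {R : realType} {m n s : nat} (A : 'M[R]_(m, n))
    (U : 'M[R]_(m, s)) (S : 'M[R]_s) (V : 'M[R]_(n, s)) : Prop :=
  exists (t : nat) (Uc : 'M[R]_(m, t)) (Vc : 'M[R]_(n, t))
         (d : 'rV[R]_s) (dc : 'rV[R]_t),
  [/\ (s + t)%N = minn m n,
      stiefel (row_mx U Uc) /\ stiefel (row_mx V Vc),
      (forall i, 0 <= d 0 i) /\ (forall j, 0 <= dc 0 j),
      forall i j, dc 0 j <= d 0 i &
      S = diag_mx d /\ A = U *m S *m V^T + Uc *m diag_mx dc *m Vc^T].

Section AlternatingSVD.
Context {R : realType} {n1 n2 n3 r1 r2 : nat}.
Variables (Y : tensor R n1 n2 n3).
Variables (X2'' : tensor R r1 n2 r2) (X3'' : 'M[R]_(r2, n3)).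
Variables (X1' : 'M[R]_(n1, r1)) (X2' : tensor R r1 n2 r2).
Variables (s1 s2 : nat) (eps : R) (imax : nat).

Definition matA {q : nat} (V3 : 'M[R]_(q, n3)) : 'M[R]_(n1, n3 * n2) :=
  Pperp X1' *m
    (unfoldL (Y *R Pj V3^T)
     + unfoldL (Y *R X3''^T) *m Pperp (unfoldL X2'')^T
         *m (X3'' *t (1%:M : 'M[R]_n2))).

Definition matB {q : nat} (U1 : 'M[R]_(n1, q)) : 'M[R]_(n2 * n1, n3) :=
  (unfoldR (Pj U1 *L Y)
   + ((1%:M : 'M[R]_n2) *t X1') *m Pperp (unfoldR X2')
       *m unfoldR (X1'^T *L Y))
  *m Pperp X3''^T.

Definition svdA {q : nat} (V3 : 'M[R]_(q, n3))
    (U1 : 'M[R]_(n1, s1)) (S : 'M[R]_s1) : Prop :=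
  (exists V : 'M[R]_(n3 * n2, s1), truncated_svd (matA V3) U1 S V) /\
  ((\rank (matA V3) < s1)%N -> U1^T *m X1' = 0).

Definition svdB {q : nat} (U1 : 'M[R]_(n1, q))
    (S : 'M[R]_s2) (V3 : 'M[R]_(s2, n3)) : Prop :=
  (exists U : 'M[R]_(n2 * n1, s2), truncated_svd (matB U1) U S V3^T) /\
  ((\rank (matB U1) < s2)%N -> V3 *m X3''^T = 0).

(* Loop bodies: [(U, V)] are the current matrices, [(U', V')] the new ones and
   [eta'] the new value of eta_new. *)
Definition body_U_first {q1 q2 : nat} (U : 'M[R]_(n1, q1)) (V : 'M[R]_(q2, n3))
    (U' : 'M[R]_(n1, s1)) (V' : 'M[R]_(s2, n3)) (eta' : R) : Prop :=
  (exists S : 'M[R]_s1, svdA V U' S) /\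
  exists S : 'M[R]_s2, svdB U' S V' /\
    eta' = mxfrob S ^+ 2
         + mxfrob (Pj U' *m unfoldL (Y *R X3''^T) *m Pperp (unfoldL X2'')^T
                       *m (X3'' *t (1%:M : 'M[R]_n2))) ^+ 2.

Definition body_V_first {q1 q2 : nat} (U : 'M[R]_(n1, q1)) (V : 'M[R]_(q2, n3))
    (U' : 'M[R]_(n1, s1)) (V' : 'M[R]_(s2, n3)) (eta' : R) : Prop :=
  (exists S : 'M[R]_s2, svdB U S V') /\
  exists S : 'M[R]_s1, svdA V' U' S /\
    eta' = mxfrob S ^+ 2
         + mxfrob (((1%:M : 'M[R]_n2) *t X1') *m Pperp (unfoldR X2')
                       *m unfoldR (X1'^T *L Y) *m Pj V'^T) ^+ 2.

Definition body {q1 q2 : nat} (U : 'M[R]_(n1, q1)) (V : 'M[R]_(q2, n3))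
    (U' : 'M[R]_(n1, s1)) (V' : 'M[R]_(s2, n3)) (eta' : R) : Prop :=
  if s2%:R / (n3 - r2)%:R > s1%:R / (n1 - r1)%:R :> R
  then body_U_first U V U' V' eta'
  else body_V_first U V U' V' eta'.

(* The etas are extended reals: [`|+oo - 0| = `|x%:E - +oo| = +oo], so that the
   second test succeeds in the first two passes. *)
Definition loop_guard (i : nat) (eta1 etanew : \bar R) : bool :=
  (i < imax)%N && (eps%:E < `|etanew - eta1|)%E.

(* Reachable states (i, eta_1, eta_new, U_1, V_3) at the head of the loop.  The
   sizes of U_1 and V_3 are part of the state because the initial matrices are
   square. *)
Inductive reachable : nat -> \bar R -> \bar R ->
    forall q1 q2 : nat, 'M[R]_(n1, q1) -> 'M[R]_(q2, n3) -> Prop :=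
| reachable_init : reachable 0 0%E +oo%E (Pperp X1') (Pperp X3''^T)
| reachable_step i eta1 etanew q1 q2
    (U : 'M[R]_(n1, q1)) (V : 'M[R]_(q2, n3)) U' V' eta' :
    reachable i eta1 etanew U V -> loop_guard i eta1 etanew ->
    body U V U' V' eta' ->
    reachable i.+1 etanew eta'%:E U' V'.

Definition algorithm_output (U1 : 'M[R]_(n1, s1)) (V3 : 'M[R]_(s2, n3)) : Prop :=
  exists (i : nat) (eta1 etanew : \bar R),
    reachable i eta1 etanew U1 V3 /\ ~~ loop_guard i eta1 etanew.

End AlternatingSVD.

(* Main.v *)
Require Import Defs.
From mathcomp Require Import all_boot all_order all_algebra.
From mathcomp Require Import boolp classical_sets reals ereal topology normedtype
  sequences realfun perm.
From mathcomp.real_closed Require Import mxtens.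
From mathcomp Require Import ring lra.

Set Implicit Arguments.
Unset Strict Implicit.
Unset Printing Implicit Defensive.

Import Order.TTheory GRing.Theory Num.Theory.
Import numFieldNormedType.Exports.

Local Open Scope ring_scope.

(** Work in the Euclidean space of tensors. Splitting the first mode along the
column space of [X1'] and the third along the row space of [X3''] cuts it into four
blocks. When the columns of [U1] and the rows of [V3] lie in the complements of
these two spaces, [Ytilde] is the image of [Y] under an orthogonal projector
[tangent_proj] built from four block projections ([tangent_orthoproj]). Hence
[tdot Y Ytilde = tdot Ytilde Ytilde], and this number is the [gain] of the pair
([U1], [V3]) plus a part that does not depend on it ([tangent_proj_dot]). The angle
condition therefore amounts to [omega * tnorm Yhat <= tnorm Ytilde].

Upper bound for [Yhat]. A tangent vector [Z] satisfies two rank conditions: its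
left unfolding, compressed to the kernels of the left unfolding of [X], has rank
at most [k1 - r1], and similarly on the right ([determinantal_tangent_rank]).
Projecting onto the column and row spaces of the two compressions gives a frame
pair for which [tangent_proj] fixes [Z] ([tangent_cone_fixed]). As the tangent
cone is a cone, [Yhat] satisfies [tdot Yhat Yhat <= tdot Y Yhat], so by
Cauchy-Schwarz [tnorm Yhat] is at most the norm of some [tangent_proj QU QV Y].

Lower bound for [Ytilde]. It remains to see that the algorithm returns a pair
whose gain is at least [omega ^+ 2] times that of any competing pair
([algorithm_output_near_optimal]). Both halves of a pass maximize the part of the
gain that depends on one of the two frames, by Ky Fan's principle
([truncated_svd_max]). In the first pass the first half uses the whole complement
for the other frame, so its result is at least as good as any pair; the second
half keeps at least the average proportion [s / (n - r)] of it, and the mode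
updated last is the one with the larger proportion, [omega ^+ 2]. Later passes
never decrease the gain.

Finally [Ytilde] is tangent because it is the velocity of the curve obtained by
moving all the blocks of a bordered decomposition of [X] at once ([ttd_tangent]).
The two given decompositions are first written with a common core; minimality of
([r1], [r2]) makes the changes of basis invertible ([C_unit], [D_unit]). *)

(** * Tensor algebra *)

(** The two unfoldings let matrices act on the last two, respectively the first
two, indices of a tensor at once. *)
Definition ract {R : pzRingType} {a b c b' c' : nat}
    (T : tensor R a b c) (N : 'M[R]_(c * b, c' * b')) : tensor R a b' c' :=
  foldL (unfoldL T *m N).

Definition lact {R : pzRingType} {a b c a' b' : nat}
    (M : 'M[R]_(b' * a', b * a)) (T : tensor R a b c) : tensor R a' b' c :=
  foldR (M *m unfoldR T).

Lemma tensmx1 (R : pzRingType) m n :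
  (1%:M : 'M[R]_m) *t (1%:M : 'M[R]_n) = 1%:M.
Proof.
apply/matrixP => k l.
case: (mxtens_indexP k) => i j; case: (mxtens_indexP l) => i' j'.
rewrite tensmxE !mxE -natrM mulnb (can_eq (@mxtens_indexK m n)).
by rewrite xpair_eqE.
Qed.

Section TensorAlgebra.
Context {R : comPzRingType}.

Lemma unfoldLK {S : Type} {a b c} : cancel (@unfoldL S a b c) foldL.
Proof. by move=> T; apply/ffunP=> -[[i j] k]; rewrite ffunE mxE mxtens_indexK. Qed.

Lemma foldLK {S : Type} {a b c} : cancel (@foldL S a b c) unfoldL.
Proof.
move=> M; apply/matrixP=> i l.
by rewrite mxE ffunE -surjective_pairing mxtens_unindexK.
Qed.

Lemma unfoldRK {S : Type} {a b c} : cancel (@unfoldR S a b c) foldR.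
Proof. by move=> T; apply/ffunP=> -[[i j] k]; rewrite ffunE mxE mxtens_indexK. Qed.

Lemma foldRK {S : Type} {a b c} : cancel (@foldR S a b c) unfoldR.
Proof.
move=> M; apply/matrixP=> i l.
by rewrite mxE ffunE -surjective_pairing mxtens_unindexK.
Qed.

Lemma contrLE a' a b c (A : 'M[R]_(a', a)) (T : tensor R a b c) i j k :
  (A *L T) (i, j, k) = \sum_l A i l * T (l, j, k).
Proof.
rewrite ffunE mxE; apply: eq_bigr => l _.
by rewrite mxE mxtens_indexK.
Qed.

Lemma contrRE a b c c' (T : tensor R a b c) (B : 'M[R]_(c, c')) i j k :
  (T *R B) (i, j, k) = \sum_l T (i, j, l) * B l k.
Proof.
rewrite ffunE mxE; apply: eq_bigr => l _.
by rewrite mxE mxtens_indexK.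
Qed.

Lemma sum_mxtens (V : nmodType) m n (F : 'I_(m * n) -> V) :
  \sum_l F l = \sum_i \sum_j F (mxtens_index (i, j)).
Proof.
rewrite pair_big /= (reindex (@mxtens_index m n)) /=.
  by apply: eq_bigr => -[i j] _.
by exists (@mxtens_unindex m n) => i _; rewrite (mxtens_indexK, mxtens_unindexK).
Qed.

Lemma unfoldL_contrL a' a b c (A : 'M[R]_(a', a)) (T : tensor R a b c) :
  unfoldL (A *L T) = A *m unfoldL T.
Proof. exact: foldLK. Qed.

Lemma unfoldR_contrR a b c c' (T : tensor R a b c) (B : 'M[R]_(c, c')) :
  unfoldR (T *R B) = unfoldR T *m B.
Proof. exact: foldRK. Qed.

Lemma contrLA a a' a'' b c (A : 'M[R]_(a'', a')) (B : 'M[R]_(a', a))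
    (T : tensor R a b c) : A *L (B *L T) = (A *m B) *L T.
Proof. by rewrite /contrL foldLK mulmxA. Qed.

Lemma contrRA a b c c' c'' (T : tensor R a b c) (A : 'M[R]_(c, c'))
    (B : 'M[R]_(c', c'')) : T *R A *R B = T *R (A *m B).
Proof. by rewrite /contrR foldRK mulmxA. Qed.

Lemma contrR_ract a b c c' (T : tensor R a b c) (B : 'M[R]_(c, c')) :
  T *R B = ract T (B *t (1%:M : 'M_b)).
Proof.
apply/ffunP=> -[[i j] k]; rewrite contrRE ffunE mxE sum_mxtens.
apply: eq_bigr => l _; rewrite (bigD1 j) //= big1 => [|j' ne].
  by rewrite addr0 tensmxE !mxE mxtens_indexK eqxx mulr1.
by rewrite tensmxE !mxE (negbTE ne) !mulr0.
Qed.

Lemma contrL_lact a' a b c (A : 'M[R]_(a', a)) (T : tensor R a b c) :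
  A *L T = lact ((1%:M : 'M_b) *t A) T.
Proof.
apply/ffunP=> -[[i j] k]; rewrite contrLE ffunE mxE sum_mxtens.
rewrite [RHS](bigD1 j) //= [X in _ + X]big1 ?addr0 => [|j' ne].
  by apply: eq_bigr => l _; rewrite tensmxE !mxE mxtens_indexK eqxx mul1r.
by apply: big1 => l _; rewrite tensmxE !mxE eq_sym (negbTE ne) !mul0r.
Qed.

Lemma unfoldL_contrR a b c c' (T : tensor R a b c) (B : 'M[R]_(c, c')) :
  unfoldL (T *R B) = unfoldL T *m (B *t (1%:M : 'M_b)).
Proof. by rewrite contrR_ract foldLK. Qed.

Lemma unfoldR_contrL a' a b c (A : 'M[R]_(a', a)) (T : tensor R a b c) :
  unfoldR (A *L T) = ((1%:M : 'M_b) *t A) *m unfoldR T.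
Proof. by rewrite contrL_lact foldRK. Qed.

Lemma ractA a b c b' c' b'' c'' (T : tensor R a b c)
    (M : 'M[R]_(c * b, c' * b')) (N : 'M[R]_(c' * b', c'' * b'')) :
  ract (ract T M) N = ract T (M *m N).
Proof. by rewrite /ract foldLK mulmxA. Qed.

Lemma lactA a b c a' b' a'' b'' (T : tensor R a b c)
    (M : 'M[R]_(b' * a', b * a)) (N : 'M[R]_(b'' * a'', b' * a')) :
  lact N (lact M T) = lact (N *m M) T.
Proof. by rewrite /lact foldRK mulmxA. Qed.

Lemma contrL_ractC a' a b c b' c' (A : 'M[R]_(a', a)) (T : tensor R a b c)
    (N : 'M[R]_(c * b, c' * b')) : A *L ract T N = ract (A *L T) N.
Proof. by rewrite /ract /contrL !foldLK mulmxA. Qed.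

Lemma lact_contrRC a b c a' b' c' (M : 'M[R]_(b' * a', b * a))
    (T : tensor R a b c) (B : 'M[R]_(c, c')) :
  lact M T *R B = lact M (T *R B).
Proof. by rewrite /lact /contrR !foldRK mulmxA. Qed.

Lemma contrLR a' a b c c' (A : 'M[R]_(a', a)) (T : tensor R a b c)
    (B : 'M[R]_(c, c')) : A *L (T *R B) = A *L T *R B.
Proof. by rewrite !contrR_ract contrL_ractC. Qed.

Lemma contr1L a b c (T : tensor R a b c) : 1%:M *L T = T.
Proof. by rewrite /contrL mul1mx unfoldLK. Qed.

Lemma contr1R a b c (T : tensor R a b c) : T *R 1%:M = T.
Proof. by rewrite /contrR mulmx1 unfoldRK. Qed.

End TensorAlgebra.

Section TensorEntries.
Context {R : realType} {a b c : nat}.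
Implicit Types (S T : tensor R a b c) (t : R).

Lemma tensorDE S T p : (S + T) p = S p + T p.
Proof. by rewrite ffunE. Qed.

Lemma tensorBE S T p : (S - T) p = S p - T p.
Proof. by rewrite !ffunE. Qed.

Lemma tensor0E p : (0 : tensor R a b c) p = 0.
Proof. by rewrite ffunE. Qed.

Lemma tensorZE t T p : (t *: T) p = t * T p.
Proof. by rewrite ffunE. Qed.

Lemma unfoldLD S T : unfoldL (S + T) = unfoldL S + unfoldL T.
Proof. by apply/matrixP=> i l; rewrite !(mxE, tensorDE). Qed.

Lemma unfoldLB S T : unfoldL (S - T) = unfoldL S - unfoldL T.
Proof. by apply/matrixP=> i l; rewrite !(mxE, tensorBE). Qed.

Lemma unfoldLZ t T : unfoldL (t *: T) = t *: unfoldL T.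
Proof. by apply/matrixP=> i l; rewrite !(mxE, tensorZE). Qed.

Lemma unfoldRD S T : unfoldR (S + T) = unfoldR S + unfoldR T.
Proof. by apply/matrixP=> i l; rewrite !(mxE, tensorDE). Qed.

Lemma unfoldRB S T : unfoldR (S - T) = unfoldR S - unfoldR T.
Proof. by apply/matrixP=> i l; rewrite !(mxE, tensorBE). Qed.

Lemma unfoldRZ t T : unfoldR (t *: T) = t *: unfoldR T.
Proof. by apply/matrixP=> i l; rewrite !(mxE, tensorZE). Qed.

Lemma foldLD (M N : 'M[R]_(a, c * b)) :
  foldL (M + N) = foldL M + foldL N :> tensor R a b c.
Proof. by apply/ffunP=> p; rewrite tensorDE !(mxE, ffunE). Qed.

Lemma foldLB (M N : 'M[R]_(a, c * b)) :
  foldL (M - N) = foldL M - foldL N :> tensor R a b c.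
Proof. by apply/ffunP=> p; rewrite tensorBE !(mxE, ffunE). Qed.

Lemma foldLZ t (M : 'M[R]_(a, c * b)) :
  foldL (t *: M) = t *: foldL M :> tensor R a b c.
Proof. by apply/ffunP=> p; rewrite tensorZE !(mxE, ffunE). Qed.

Lemma foldL0 : foldL (0 : 'M[R]_(a, c * b)) = 0 :> tensor R a b c.
Proof. by apply/ffunP=> p; rewrite tensor0E !(mxE, ffunE). Qed.

Lemma foldRD (M N : 'M[R]_(b * a, c)) :
  foldR (M + N) = foldR M + foldR N :> tensor R a b c.
Proof. by apply/ffunP=> p; rewrite tensorDE !(mxE, ffunE). Qed.

Lemma foldRB (M N : 'M[R]_(b * a, c)) :
  foldR (M - N) = foldR M - foldR N :> tensor R a b c.
Proof. by apply/ffunP=> p; rewrite tensorBE !(mxE, ffunE). Qed.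

Lemma foldRZ t (M : 'M[R]_(b * a, c)) :
  foldR (t *: M) = t *: foldR M :> tensor R a b c.
Proof. by apply/ffunP=> p; rewrite tensorZE !(mxE, ffunE). Qed.

Lemma foldR0 : foldR (0 : 'M[R]_(b * a, c)) = 0 :> tensor R a b c.
Proof. by apply/ffunP=> p; rewrite tensor0E !(mxE, ffunE). Qed.

End TensorEntries.

Section TensorLinear.
Context {R : realType} {a b c : nat}.
Implicit Types (S T : tensor R a b c) (t : R).

Lemma contrLDr a' (A : 'M[R]_(a', a)) S T : A *L (S + T) = A *L S + A *L T.
Proof. by rewrite /contrL unfoldLD mulmxDr foldLD. Qed.

Lemma contrLZr a' (A : 'M[R]_(a', a)) t T : A *L (t *: T) = t *: (A *L T).
Proof. by rewrite /contrL unfoldLZ -scalemxAr foldLZ. Qed.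

Lemma contrLDl a' (A B : 'M[R]_(a', a)) T : (A + B) *L T = A *L T + B *L T.
Proof. by rewrite /contrL mulmxDl foldLD. Qed.

Lemma contrLZl a' (A : 'M[R]_(a', a)) t T : (t *: A) *L T = t *: (A *L T).
Proof. by rewrite /contrL -scalemxAl foldLZ. Qed.

Lemma contrLBl a' (A B : 'M[R]_(a', a)) T : (A - B) *L T = A *L T - B *L T.
Proof. by rewrite /contrL mulmxBl foldLB. Qed.

Lemma contr0L a' T : (0 : 'M[R]_(a', a)) *L T = 0.
Proof. by rewrite /contrL mul0mx foldL0. Qed.

Lemma contrL0 a' (A : 'M[R]_(a', a)) : A *L (0 : tensor R a b c) = 0.
Proof. by rewrite -[in LHS](scale0r (0 : tensor R a b c)) contrLZr scale0r. Qed.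

Lemma contrRDl c' S T (B : 'M[R]_(c, c')) : (S + T) *R B = S *R B + T *R B.
Proof. by rewrite /contrR unfoldRD mulmxDl foldRD. Qed.

Lemma contrRZl c' t T (B : 'M[R]_(c, c')) : (t *: T) *R B = t *: (T *R B).
Proof. by rewrite /contrR unfoldRZ -scalemxAl foldRZ. Qed.

Lemma contrRDr c' T (A B : 'M[R]_(c, c')) : T *R (A + B) = T *R A + T *R B.
Proof. by rewrite /contrR mulmxDr foldRD. Qed.

Lemma contrRZr c' T t (B : 'M[R]_(c, c')) : T *R (t *: B) = t *: (T *R B).
Proof. by rewrite /contrR -scalemxAr foldRZ. Qed.

Lemma contrRBr c' T (A B : 'M[R]_(c, c')) : T *R (A - B) = T *R A - T *R B.
Proof. by rewrite /contrR mulmxBr foldRB. Qed.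

Lemma contrR0 c' T : T *R (0 : 'M[R]_(c, c')) = 0.
Proof. by rewrite /contrR mulmx0 foldR0. Qed.

Lemma contr0R c' (B : 'M[R]_(c, c')) : (0 : tensor R a b c) *R B = 0.
Proof. by rewrite -[in LHS](scale0r (0 : tensor R a b c)) contrRZl scale0r. Qed.

Lemma ractDr b' c' T (A B : 'M[R]_(c * b, c' * b')) :
  ract T (A + B) = ract T A + ract T B.
Proof. by rewrite /ract mulmxDr foldLD. Qed.

Lemma ract0 b' c' T : ract T (0 : 'M[R]_(c * b, c' * b')) = 0.
Proof. by rewrite /ract mulmx0 foldL0. Qed.

Lemma lactDl a' b' T (A B : 'M[R]_(b' * a', b * a)) :
  lact (A + B) T = lact A T + lact B T.
Proof. by rewrite /lact mulmxDl foldRD. Qed.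

Lemma lact0 a' b' T : lact (0 : 'M[R]_(b' * a', b * a)) T = 0.
Proof. by rewrite /lact mul0mx foldR0. Qed.

Lemma lact0r a' b' (M : 'M[R]_(b' * a', b * a)) :
  lact M (0 : tensor R a b c) = 0.
Proof.
rewrite /lact -[X in unfoldR X](scale0r (0 : tensor R a b c)) unfoldRZ scale0r.
by rewrite mulmx0 foldR0.
Qed.

End TensorLinear.

(** * Orthogonal projectors *)

Section Projectors.
Context {R : realType} {a b c : nat}.
Implicit Types (S T : tensor R a b c) (t : R).

Lemma tdotC S T : tdot S T = tdot T S.
Proof. by apply: eq_bigr => p _; rewrite mulrC. Qed.

Lemma tdotDl S T Z : tdot (S + T) Z = tdot S Z + tdot T Z.
Proof. by rewrite -big_split; apply: eq_bigr => p _; rewrite tensorDE mulrDl. Qed.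

Lemma tdotDr S T Z : tdot Z (S + T) = tdot Z S + tdot Z T.
Proof. by rewrite tdotC tdotDl !(tdotC Z). Qed.

Lemma tdotZl t S T : tdot (t *: S) T = t * tdot S T.
Proof. by rewrite mulr_sumr; apply: eq_bigr => p _; rewrite tensorZE mulrA. Qed.

Lemma tdotZr t S T : tdot S (t *: T) = t * tdot S T.
Proof. by rewrite tdotC tdotZl tdotC. Qed.

Lemma tdotNr S T : tdot S (- T) = - tdot S T.
Proof. by rewrite -scaleN1r tdotZr mulN1r. Qed.

Lemma tdotBr S T Z : tdot Z (S - T) = tdot Z S - tdot Z T.
Proof. by rewrite tdotDr tdotNr. Qed.

Lemma tdotBl S T Z : tdot (S - T) Z = tdot S Z - tdot T Z.
Proof. by rewrite tdotC tdotBr !(tdotC Z). Qed.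

Lemma tdot0r S : tdot S 0 = 0.
Proof. by apply: big1 => p _; rewrite tensor0E mulr0. Qed.

Lemma tdot_ge0 T : 0 <= tdot T T.
Proof. by apply: sumr_ge0 => p _; rewrite -expr2 sqr_ge0. Qed.

Lemma tdot_eq0 T : tdot T T = 0 -> T = 0.
Proof.
move/eqP; rewrite psumr_eq0 => [/allP h|p _]; last by rewrite -expr2 sqr_ge0.
apply/ffunP => p; rewrite tensor0E; apply/eqP.
by have := h p (mem_index_enum _); rewrite /= mulf_eq0 orbb.
Qed.

Lemma tdot_nondeg S T : (forall Z, tdot S Z = tdot T Z) -> S = T.
Proof.
move=> h; apply/eqP; rewrite -subr_eq0; apply/eqP/tdot_eq0.
by rewrite tdotBl h -tdotBl subrr tdotC tdot0r.
Qed.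

Lemma tnorm_ge0 T : 0 <= tnorm T.
Proof. exact: sqrtr_ge0. Qed.

Lemma tnorm_sqr T : tnorm T ^+ 2 = tdot T T.
Proof. by rewrite sqr_sqrtr // tdot_ge0. Qed.

(** An orthogonal projector is recorded as a self-adjoint idempotent map. Its
linearity is a consequence, because the inner product is nondegenerate. *)
Definition orthoproj (P : tensor R a b c -> tensor R a b c) : Prop :=
  (forall S T, tdot (P S) T = tdot S (P T)) /\ (forall T, P (P T) = P T).

Implicit Types P Q : tensor R a b c -> tensor R a b c.

Lemma orthoprojD P S T : orthoproj P -> P (S + T) = P S + P T.
Proof.
by case=> adjP _; apply: tdot_nondeg => Z; rewrite adjP !tdotDl !adjP.
Qed.

Lemma orthoprojB P S T : orthoproj P -> P (S - T) = P S - P T.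
Proof.
by case=> adjP _; apply: tdot_nondeg => Z; rewrite adjP !tdotBl !adjP.
Qed.

Lemma orthoproj_comp P Q :
  orthoproj P -> orthoproj Q -> (forall T, P (Q T) = Q (P T)) ->
  orthoproj (fun T => P (Q T)).
Proof.
move=> [aP iP] [aQ iQ] PQ; split=> [S T|T]; first by rewrite aP aQ PQ.
by rewrite -PQ iP iQ.
Qed.

Lemma orthoproj_add P Q :
  orthoproj P -> orthoproj Q -> (forall T, P (Q T) = 0) ->
  orthoproj (fun T => P T + Q T).
Proof.
move=> oP oQ PQ; case: (oP) (oQ) => [aP iP] [aQ iQ].
have QP T : Q (P T) = 0.
  by apply: tdot_nondeg => S; rewrite aQ aP PQ (tdotC 0) !tdot0r.
split=> [S T|T]; first by rewrite tdotDl tdotDr aP aQ.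
by rewrite (orthoprojD _ _ oP) (orthoprojD _ _ oQ) iP iQ PQ QP addr0 add0r.
Qed.

Lemma orthoproj_dot P T : orthoproj P -> tdot (P T) (P T) = tdot T (P T).
Proof. by case=> aP iP; rewrite aP iP. Qed.

Lemma orthoproj_dot_ge0 P T : orthoproj P -> 0 <= tdot T (P T).
Proof. by move=> oP; rewrite -orthoproj_dot // tdot_ge0. Qed.

Lemma cauchy_schwarz S T : tdot S T <= tnorm S * tnorm T.
Proof.
have [->|S0] := eqVneq S 0; first by rewrite tdotC tdot0r mulr_ge0 // tnorm_ge0.
have SS0 : 0 < tdot S S.
  rewrite lt_neqAle tdot_ge0 andbT eq_sym; apply: contraNneq S0 => h.
  exact/eqP/tdot_eq0.
have [st|st] := ltP 0 (tdot S T); last first.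
  by apply: le_trans st _; rewrite mulr_ge0 // tnorm_ge0.
rewrite -ler_sqr ?nnegrE ?mulr_ge0 ?tnorm_ge0 ?(ltW st) //.
rewrite exprMn !tnorm_sqr.
have := tdot_ge0 (tdot S S *: T - tdot S T *: S).
rewrite !tdotBl !tdotBr !tdotZl !tdotZr (tdotC T S) => h.
have {}h : 0 <= tdot S S * (tdot S S * tdot T T - tdot S T ^+ 2).
  by move: h; nra.
by move: h; rewrite pmulr_rge0 // subr_ge0 expr2.
Qed.

End Projectors.

Section ProjectorInstances.
Context {R : realType} {a b c : nat}.

Lemma tdot_unfoldL (S T : tensor R a b c) :
  tdot S T = \tr (unfoldL S *m (unfoldL T)^T).
Proof.
rewrite /tdot /mxtrace (eq_bigr (fun p => S (p.1, p.2) * T (p.1, p.2))); last first.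
  by case.
rewrite -(pair_bigA _ (fun p k => S (p, k) * T (p, k))) /=.
rewrite (eq_bigr (fun p => \sum_k S (p.1, p.2, k) * T (p.1, p.2, k))); last first.
  by case.
rewrite -(pair_bigA _ (fun i j => \sum_k S (i, j, k) * T (i, j, k))) /=.
apply: eq_bigr => i _; rewrite mxE sum_mxtens exchange_big /=.
by apply: eq_bigr => j _; apply: eq_bigr => k _; rewrite !mxE mxtens_indexK.
Qed.

Lemma tdot_unfoldR (S T : tensor R a b c) :
  tdot S T = \tr ((unfoldR S)^T *m unfoldR T).
Proof.
rewrite /tdot /mxtrace (eq_bigr (fun p => S (p.1, p.2) * T (p.1, p.2))); last first.
  by case.
rewrite -(pair_bigA _ (fun p k => S (p, k) * T (p, k))) /= exchange_big /=.
apply: eq_bigr => k _.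
rewrite (eq_bigr (fun p => S (p.1, p.2, k) * T (p.1, p.2, k))); last by case.
rewrite -(pair_bigA _ (fun i j => S (i, j, k) * T (i, j, k))) /=.
rewrite mxE sum_mxtens exchange_big /=.
by apply: eq_bigr => j _; apply: eq_bigr => i _; rewrite !mxE mxtens_indexK.
Qed.

Definition projmx n (P : 'M[R]_n) : Prop := P^T = P /\ P *m P = P.

Lemma ract_orthoproj (N : 'M[R]_(c * b)) :
  projmx N -> orthoproj (fun T : tensor R a b c => ract T N).
Proof.
case=> sN iN; split=> [S T|T]; last by rewrite ractA iN.
by rewrite !tdot_unfoldL !foldLK trmx_mul sN mulmxA.
Qed.

Lemma lact_orthoproj (M : 'M[R]_(b * a)) :
  projmx M -> orthoproj (fun T : tensor R a b c => lact M T).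
Proof.
case=> sM iM; split=> [S T|T]; last by rewrite lactA iM.
by rewrite !tdot_unfoldR !foldRK trmx_mul sM mulmxA.
Qed.

Lemma contrL_orthoproj (A : 'M[R]_a) :
  projmx A -> orthoproj (fun T : tensor R a b c => A *L T).
Proof.
case=> sA iA; split=> [S T|T]; last by rewrite contrLA iA.
rewrite !tdot_unfoldL !foldLK trmx_mul sA mxtrace_mulC !mulmxA.
by rewrite mxtrace_mulC mulmxA.
Qed.

Lemma contrR_orthoproj (B : 'M[R]_c) :
  projmx B -> orthoproj (fun T : tensor R a b c => T *R B).
Proof.
case=> sB iB; split=> [S T|T]; last by rewrite contrRA iB.
rewrite !tdot_unfoldR !foldRK trmx_mul sB mxtrace_mulC !mulmxA.
by rewrite mxtrace_mulC mulmxA.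
Qed.

End ProjectorInstances.

(** * Projector matrices and truncated singular value decompositions *)

Section ProjectorMatrices.
Context {R : realType}.

Lemma trmx_Pj n p (U : 'M[R]_(n, p)) : (Pj U)^T = Pj U.
Proof. by rewrite trmx_mul trmxK. Qed.

Lemma projmx_stiefel n p (U : 'M[R]_(n, p)) : stiefel U -> projmx (Pj U).
Proof.
move=> oU; split; first exact: trmx_Pj.
by rewrite /Pj mulmxA -(mulmxA U) oU mulmx1.
Qed.

Lemma projmx_compl n (P : 'M[R]_n) : projmx P -> projmx (1%:M - P).
Proof.
case=> sP iP; split; first by rewrite linearB /= trmx1 sP.
by rewrite mulmxBl mulmxBr mulmx1 mul1mx mulmxBr mulmx1 iP subrr subr0.
Qed.

Lemma Pj_projmx n (P : 'M[R]_n) : projmx P -> Pj P = P.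
Proof. by case=> sP iP; rewrite /Pj sP iP. Qed.

Lemma projmx_mul0 n (P Q : 'M[R]_n) :
  projmx P -> projmx Q -> P *m Q = 0 -> Q *m P = 0.
Proof.
by move=> [sP _] [sQ _] PQ; rewrite -[LHS]trmxK trmx_mul sP sQ PQ trmx0.
Qed.

Lemma projmx_sub n (P Q : 'M[R]_n) :
  projmx P -> projmx Q -> Q *m P = Q ->
  [/\ projmx (P - Q), Q *m (P - Q) = 0, (P - Q) *m Q = 0 & (P - Q) *m P = P - Q].
Proof.
move=> [sP iP] [sQ iQ] QP.
have PQ : P *m Q = Q by rewrite -[LHS]trmxK trmx_mul sP sQ QP sQ.
split.
- split; first by rewrite linearB /= sP sQ.
  by rewrite mulmxBl !mulmxBr iP iQ QP PQ subrr subr0.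
- by rewrite mulmxBr QP iQ subrr.
- by rewrite mulmxBl PQ iQ subrr.
- by rewrite mulmxBl iP QP.
Qed.

Lemma gram_diag_ge0 m n (M : 'M[R]_(m, n)) k : 0 <= (M^T *m M) k k.
Proof. by rewrite mxE; apply: sumr_ge0 => i _; rewrite !mxE -expr2 sqr_ge0. Qed.

Lemma projmx_diag_ge0 m n (P : 'M[R]_m) (W : 'M[R]_(m, n)) k :
  projmx P -> 0 <= (W^T *m P *m W) k k.
Proof.
case=> sP iP; rewrite -iP mulmxA -mulmxA -{1}sP -trmx_mul.
exact: gram_diag_ge0.
Qed.

Lemma projmx_trace_ge0 m n (P : 'M[R]_m) (W : 'M[R]_(m, n)) :
  projmx P -> 0 <= \tr (W^T *m P *m W).
Proof. by move=> oP; apply: sumr_ge0 => k _; apply: projmx_diag_ge0. Qed.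

Lemma gram_eq0 m n (M : 'M[R]_(m, n)) : M^T *m M = 0 -> M = 0.
Proof.
move=> h; apply/matrixP=> i j; move/matrixP/(_ j j): h.
rewrite !mxE => /eqP; rewrite psumr_eq0 => [/allP h|l _]; last first.
  by rewrite mxE -expr2 sqr_ge0.
by have := h i (mem_index_enum _); rewrite /= mxE mulf_eq0 orbb => /eqP.
Qed.

Lemma stiefel_row m s t (U : 'M[R]_(m, s)) (Uc : 'M[R]_(m, t)) :
  stiefel (row_mx U Uc) ->
  [/\ U^T *m U = 1%:M, U^T *m Uc = 0, Uc^T *m U = 0 & Uc^T *m Uc = 1%:M].
Proof.
by rewrite /stiefel /= tr_row_mx mul_col_row scalar_mx_block => /eq_block_mx[].
Qed.

(** Ky Fan's principle after diagonalization: weights at most 1 on the [s] largest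
values, nonnegative on the others and of total mass at most [s] cannot give more
than weight 1 on the largest values. Both sides are compared with a threshold that
separates the two groups. *)
Lemma weighted_sum_le s t (d : 'I_s -> R) (dc : 'I_t -> R)
    (w : 'I_s -> R) (wc : 'I_t -> R) :
  (forall j, 0 <= dc j) -> (forall i j, dc j <= d i) ->
  (forall i, 0 <= d i) ->
  (forall i, w i <= 1) -> (forall j, 0 <= wc j) ->
  \sum_i w i + \sum_j wc j <= s%:R ->
  \sum_i w i * d i + \sum_j wc j * dc j <= \sum_i d i.
Proof.
move=> dc_ge0 dc_le d_ge0 w_le1 wc_ge0 mass.
(* The threshold; the default value 0 is used when the second group is empty. *)
pose l : R := \big[Num.max/0]_j dc j.
have l_ge j : dc j <= l by exact: le_bigmax.
have l_le i : l <= d i by apply/bigmax_leP; split.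
have l_ge0 : 0 <= l by exact: bigmax_ge_id.
have hc : \sum_j wc j * dc j <= l * \sum_j wc j.
  by rewrite mulr_sumr; apply: ler_sum => j _; rewrite mulrC ler_wpM2r.
have h : l * (s%:R - \sum_i w i) <= \sum_i d i - \sum_i w i * d i.
  rewrite -[s in s%:R]card_ord -sum1_card natr_sum -!sumrB mulr_sumr.
  apply: ler_sum => i _; rewrite -[X in _ <= X - _]mul1r -mulrBl mulrC.
  by rewrite ler_wpM2l // subr_ge0.
have : l * \sum_j wc j <= l * (s%:R - \sum_i w i).
  by rewrite ler_wpM2l // lerBrDl.
lra.
Qed.

(** Ky Fan's maximum principle. The factor [c] covers two uses at once: with
[c = 1] it says that the leading singular vectors are optimal among subspaces of
the same dimension; with [c = s / \tr P] and [P] fixing [A], that they capture at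
least the average share of [A]. *)
Lemma truncated_svd_max m n s (A : 'M[R]_(m, n)) (U : 'M[R]_(m, s))
    (S : 'M[R]_s) (V : 'M[R]_(n, s)) (P : 'M[R]_m) (c : R) :
  truncated_svd A U S V -> projmx P -> 0 <= c <= 1 -> c * \tr P <= s%:R ->
  c * \tr (A^T *m P *m A) <= \tr (A^T *m Pj U *m A).
Proof.
case=> t [Uc [Vc [d [dc [_ [oU oV] [d_ge0 dc_ge0] dc_le [defS defA]]]]]] oP.
case/andP=> c_ge0 c_le1 mass.
pose W := row_mx U Uc; pose D := diag_mx (row_mx d dc).
have [UU UUc UcU UcUc] := stiefel_row oU.
have [VV VVc VcV VcVc] := stiefel_row oV.
have defA' : A = W *m D *m (row_mx V Vc)^T.
  rewrite /W /D diag_mx_row tr_row_mx mul_row_block !mulmx0 addr0 add0r.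
  by rewrite mul_row_col defA defS.
have AA : A *m A^T = W *m (D *m D) *m W^T.
  rewrite defA' !trmx_mul trmxK tr_diag_mx -!mulmxA.
  by rewrite [X in _ *m (_ *m X)]mulmxA oV mul1mx.
have AE Q : \tr (A^T *m Q *m A)
    = \sum_k (W^T *m Q *m W) k k * (row_mx d dc 0 k) ^+ 2.
  rewrite -mulmxA mxtrace_mulC -(mulmxA Q) AA mulmxA mxtrace_mulC !mulmxA.
  apply: eq_bigr => k _; rewrite -[_ *m D *m D]mulmxA.
  by rewrite mulmx_diag mul_mx_diag !mxE expr2.
have UA : \tr (A^T *m Pj U *m A) = \sum_i d 0 i ^+ 2.
  have UtA : U^T *m A = S *m V^T.
    by rewrite defA mulmxDr !mulmxA UU UUc mul1mx !mul0mx addr0.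
  rewrite /Pj mulmxA -mulmxA -[A^T *m U]trmxK trmx_mul trmxK UtA.
  rewrite mxtrace_mulC trmx_mul trmxK mulmxA -(mulmxA S) VV mulmx1.
  rewrite defS tr_diag_mx mulmx_diag /mxtrace.
  by apply: eq_bigr => i _; rewrite !mxE eqxx mulr1n expr2.
(* The weights are the diagonal entries of [P] in the orthonormal system [W]. *)
pose g k := (W^T *m P *m W) k k.
have g_ge0 k : 0 <= g k by exact: projmx_diag_ge0.
have g_le1 k : g k <= 1.
  have := projmx_diag_ge0 W k (projmx_compl oP).
  rewrite mulmxBr mulmxBl mulmx1 oU mxE [1%:M k k]mxE [X in _ + X]mxE eqxx.
  by rewrite subr_ge0.
have g_sum : \sum_k g k <= \tr P.
  have := projmx_trace_ge0 P (projmx_compl (projmx_stiefel oU)).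
  case: (oP) => sP iP.
  rewrite sP mulmxBr mulmxBl mulmx1 iP linearB /= subr_ge0.
  move/(le_trans _); apply.
  by rewrite -mulmxA mxtrace_mulC -mulmxA iP /Pj -mulmxA mxtrace_mulC.
rewrite UA AE big_split_ord /= mulrDr !mulr_sumr.
rewrite (eq_bigr (fun i => c * g (lshift t i) * d 0 i ^+ 2)); last first.
  by move=> i _; rewrite row_mxEl mulrA.
rewrite [X in _ + X](eq_bigr (fun j => c * g (rshift s j) * dc 0 j ^+ 2));
  last first.
  by move=> j _; rewrite row_mxEr mulrA.
apply: weighted_sum_le => [j|i j|i|i|j|].
- exact: sqr_ge0.
- by rewrite ler_sqr ?nnegrE.
- exact: sqr_ge0.
- by apply: mulr_ile1.
- exact: mulr_ge0.
apply: le_trans mass; rewrite -!mulr_sumr -mulrDr ler_wpM2l //.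
by move: g_sum; rewrite big_split_ord.
Qed.

Lemma truncated_svd_tr m n s (A : 'M[R]_(m, n)) (U : 'M[R]_(m, s))
    (S : 'M[R]_s) (V : 'M[R]_(n, s)) :
  truncated_svd A U S V -> truncated_svd A^T V S U.
Proof.
case=> t [Uc [Vc [d [dc [st [oU oV] ge0 dc_le [defS defA]]]]]].
exists t, Vc, Uc, d, dc; split=> //; first by rewrite minnC.
split=> //; rewrite defA linearD /= !trmx_mul !trmxK defS !tr_diag_mx.
by rewrite !mulmxA.
Qed.

Lemma truncated_svd_stiefel m n s (A : 'M[R]_(m, n)) (U : 'M[R]_(m, s))
    (S : 'M[R]_s) (V : 'M[R]_(n, s)) :
  truncated_svd A U S V -> stiefel U.
Proof. by case=> t [Uc [Vc [d [dc [_ [/stiefel_row[] ? _ _ _ _]]]]]]. Qed.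

(** If the rank of [A] is at least [s], the [s] leading singular values are
nonzero, so that their left singular vectors lie in the column space of [A]. *)
Lemma truncated_svd_orth m n s r (A : 'M[R]_(m, n)) (U : 'M[R]_(m, s))
    (S : 'M[R]_s) (V : 'M[R]_(n, s)) (X : 'M[R]_(m, r)) :
  truncated_svd A U S V -> X^T *m A = 0 ->
  ((\rank A < s)%N -> U^T *m X = 0) -> U^T *m X = 0.
Proof.
case=> t [Uc [Vc [d [dc [_ [oU oV] [d_ge0 dc_ge0] dc_le [defS defA]]]]]] XA.
case: (ltnP (\rank A) s) => [_ -> //|sA _].
have [VV VVc VcV VcVc] := stiefel_row oV.
have Sunit : S \in unitmx.
  apply: contraTT sA => nS; rewrite -ltnNge.
  move: nS; rewrite unitmxE defS det_diag unitfE negbK.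
  case/prodf_eq0 => i _ /eqP di0.
  have dc0 : dc = 0.
    by apply/rowP=> j; apply/eqP; rewrite mxE eq_le dc_ge0 andbT -di0 dc_le.
  have -> : A = U *m S *m V^T by rewrite defA dc0 raddf0 mulmx0 mul0mx addr0.
  apply: leq_ltn_trans (mxrankM_maxl _ _) _.
  apply: leq_ltn_trans (mxrankM_maxr _ _) _.
  rewrite ltn_neqAle rank_leq_row andbT; apply/negP=> fr.
  have : S \in unitmx by rewrite -row_free_unit.
  rewrite unitmxE defS det_diag unitfE => /negP; apply; apply/prodf_eq0.
  by exists i => //; apply/eqP.
have AV : A *m V = U *m S.
  by rewrite defA mulmxDl -!mulmxA VV VcV mulmx1 !mulmx0 addr0.
have XU : X^T *m U = 0.
  rewrite -(mulmxK Sunit (X^T *m U)) -(mulmxA X^T) -AV mulmxA XA.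
  by rewrite !mul0mx.
by rewrite -[LHS]trmxK trmx_mul trmxK XU trmx0.
Qed.

(** With the rows of [B] a basis of the row space of [M^T], the projector is
[B^T (B B^T)^-1 B]. Later uses need the dimension of the space only through the
trace, so that no orthonormal basis has to be constructed. *)
Lemma colspace_projmx m n (M : 'M[R]_(m, n)) :
  exists P : 'M[R]_m, [/\ projmx P, P *m M = M, \tr P = (\rank M)%:R &
    forall r (X : 'M[R]_(m, r)), X^T *m M = 0 -> P *m X = 0].
Proof.
have [q [B [freeB eqB defq]]] :
    exists q (B : 'M_(q, m)), [/\ row_free B, (B :=: M^T)%MS & q = \rank M].
  exists (\rank M^T), (row_base M^T).
  by split; [apply: row_base_free | apply: eq_row_base | apply: mxrank_tr].
pose K := B *m B^T.
have Kunit : K \in unitmx.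
  rewrite -row_free_unit -kermx_eq0; apply/eqP.
  have : (kermx K *m B) *m (kermx K *m B)^T = 0.
    by rewrite trmx_mul mulmxA -(mulmxA _ B) mulmx_ker mul0mx.
  rewrite -{1}[kermx K *m B]trmxK => /gram_eq0/(congr1 trmx).
  by rewrite trmxK trmx0 => h; apply: (row_free_inj freeB); rewrite h mul0mx.
have sK : (invmx K)^T = invmx K by rewrite trmx_inv trmx_mul trmxK.
exists (B^T *m invmx K *m B); split.
- split; first by rewrite !trmx_mul trmxK sK mulmxA.
  by rewrite !mulmxA -(mulmxA _ B) -/K mulmxKV.
- have /submxP[C MC] : (M^T <= B)%MS by rewrite eqB.
  have MBC : M = B^T *m C^T by rewrite -trmx_mul -MC trmxK.
  by rewrite MBC !mulmxA -(mulmxA _ B) -/K mulmxKV.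
- by rewrite mxtrace_mulC mulmxA -/K mulmxV // mxtrace1 defq.
- move=> r X XM; have /submxP[C BC] : (B <= M^T)%MS by rewrite eqB.
  have BX : B *m X = 0.
    by rewrite BC -mulmxA -[X]trmxK -trmx_mul XM trmx0 mulmx0.
  by rewrite -(mulmxA _ B X) BX mulmx0.
Qed.

End ProjectorMatrices.

Lemma rank_inverse (F : fieldType) m n (G : 'M[F]_(m, n)) :
  exists (L : 'M_(\rank G, m)) (K : 'M_(n, \rank G)), L *m G *m K = 1%:M.
Proof.
exists (pid_mx (\rank G) *m invmx (col_ebase G)).
exists (invmx (row_ebase G) *m pid_mx (\rank G)).
have e : invmx (col_ebase G) *m G *m invmx (row_ebase G) = pid_mx (\rank G).
  apply: (canLR (mulmxK (row_ebase_unit G))).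
  by apply: (canLR (mulKmx (col_ebase_unit G))); rewrite mulmxA mulmx_ebase.
rewrite !mulmxA -2!(mulmxA (pid_mx _)) e.
rewrite !pid_mx_id ?rank_leq_row ?rank_leq_col //.
exact: pid_mx_1.
Qed.

(** * Limits of tensors and matrices *)

Section Limits.
Local Open Scope classical_set_scope.
Local Open Scope ring_scope.
Context {R : realType}.

Lemma entry_le_tnorm a b c (T : tensor R a b c) p : `|T p| <= tnorm T.
Proof.
rewrite -sqrtr_sqr ler_wsqrtr // /tdot (bigD1 p) //= expr2 lerDl.
by apply: sumr_ge0 => q _; rewrite -expr2 sqr_ge0.
Qed.

Lemma tensor_cvg_entry a b c (u : nat -> tensor R a b c) (T : tensor R a b c) p :
  tensor_cvg u T -> (fun i => u i p) @ \oo --> T p.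
Proof.
move=> uT; apply/subr_cvg0/norm_cvg0P.
apply: (@squeeze_cvgr _ _ _ _ (fun=> 0) (fun i => tnorm (u i - T))) => //.
- by near=> i; rewrite normr_ge0 -tensorBE entry_le_tnorm.
- exact: cvg_cst.
Unshelve. all: by end_near. Qed.

Lemma tensor_cvg_of_entry a b c (u : nat -> tensor R a b c) (T : tensor R a b c) :
  (forall p, (fun i => u i p) @ \oo --> T p) -> tensor_cvg u T.
Proof.
move=> uT; rewrite /tensor_cvg /tnorm -[X in _ --> X](@sqrtr0 R).
apply: (@cvg_comp _ _ _ (fun i => tdot (u i - T) (u i - T)) Num.sqrt _ (nbhs 0));
  last first.
  exact: sqrt_continuous.
have -> : (0 : R) = \sum_(p : 'I_a * 'I_b * 'I_c) 0 * 0.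
  by rewrite big1 // => p _; rewrite mulr0.
apply: (@cvg_big _ _ +%R 0 xpredT (@add_continuous R) nat \oo _
  (fun p i => (u i - T) p * (u i - T) p)) => p _.
have up : (fun i => (u i - T) p) @ \oo --> 0.
  by under eq_cvg do rewrite tensorBE; apply/subr_cvg0.
exact: cvgM.
Qed.

Definition mxcvg m n (u : nat -> 'M[R]_(m, n)) (M : 'M[R]_(m, n)) : Prop :=
  forall i j, (fun k => u k i j) @ \oo --> M i j.

Lemma mxcvg_cst m n (M : 'M[R]_(m, n)) : mxcvg (fun=> M) M.
Proof. by move=> i j; apply: cvg_cst. Qed.

Lemma mxcvg_mul m n p (u : nat -> 'M[R]_(m, n)) (v : nat -> 'M[R]_(n, p)) M N :
  mxcvg u M -> mxcvg v N -> mxcvg (fun k => u k *m v k) (M *m N).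
Proof.
move=> uM vN i j; rewrite mxE; under eq_cvg do rewrite mxE.
apply: (@cvg_big _ _ +%R 0 xpredT (@add_continuous R) nat \oo _
  (fun l k => u k i l * v k l j)) => l _.
exact: cvgM.
Qed.

Lemma mxcvg_block m1 m2 n1 n2 (u1 : nat -> 'M[R]_(m1, n1))
    (u2 : nat -> 'M[R]_(m1, n2)) (u3 : nat -> 'M[R]_(m2, n1))
    (u4 : nat -> 'M[R]_(m2, n2)) M1 M2 M3 M4 :
  mxcvg u1 M1 -> mxcvg u2 M2 -> mxcvg u3 M3 -> mxcvg u4 M4 ->
  mxcvg (fun k => block_mx (u1 k) (u2 k) (u3 k) (u4 k)) (block_mx M1 M2 M3 M4).
Proof.
move=> h1 h2 h3 h4 i j.
case: (split_ordP i) => i' ->; case: (split_ordP j) => j' ->;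
  rewrite ?(block_mxEul, block_mxEur, block_mxEdl, block_mxEdr);
  under eq_cvg do rewrite ?(block_mxEul, block_mxEur, block_mxEdl, block_mxEdr).
- exact: h1.
- exact: h2.
- exact: h3.
- exact: h4.
Qed.

Lemma mxcvg_det n (u : nat -> 'M[R]_n) M :
  mxcvg u M -> (fun k => \det (u k)) @ \oo --> \det M.
Proof.
move=> uM; rewrite /determinant.
apply: (@cvg_big _ _ +%R 0 xpredT (@add_continuous R) nat \oo _
  (fun (s : 'S_n) k => (-1) ^+ s * \prod_i u k i (s i))) => s _.
apply: cvgM; first exact: cvg_cst.
apply: (@cvg_big R _ *%R (1 : R) xpredT (@mul_continuous R) nat \oo _
  (fun i k => u k i (s i)) (fun i => M i (s i)) _ _) => i _.
exact: uM.
Qed.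

(** Tangent directions to a determinantal variety. If [M] has rank [r] and the
compression [G] of the direction [Z] to the kernels of [M] has rank [q], then some
minor of order [r + q] of the approaching matrices, divided by [t ^ q], tends
to 1: in suitable bases it is the determinant of a matrix tending to a unipotent
block triangular one. Minors of order greater than [k] vanish, so [r + q <= k]. *)
Lemma determinantal_tangent_rank m n r k (M Z : 'M[R]_(m, n))
    (A : 'M[R]_(m, r)) (C : 'M[R]_r) (B : 'M[R]_(r, n))
    (u : nat -> 'M[R]_(m, n)) (t : nat -> R) :
  M = A *m C *m B -> A^T *m A = 1%:M -> B *m B^T = 1%:M -> C \in unitmx ->
  (forall i, 0 < t i) -> (forall i, \rank (u i) <= k)%N ->
  mxcvg u M -> mxcvg (fun i => (t i)^-1 *: (u i - M)) Z ->
  (\rank ((1%:M - A *m A^T) *m Z *m (1%:M - B^T *m B)) <= k - r)%N.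
Proof.
move=> defM oA oB Cu t_gt0 rku uM uZ.
set PA := 1%:M - A *m A^T; set PB := 1%:M - B^T *m B.
set G := _ *m PB.
have [L [K LGK]] := rank_inverse G.
have PAM : PA *m M = 0.
  by rewrite defM /PA !mulmxA mulmxBl mul1mx -(mulmxA A) oA mulmx1 subrr !mul0mx.
have MPB : M *m PB = 0.
  by rewrite defM /PB mulmxBr mulmx1 mulmxA -(mulmxA _ B) oB mulmx1 subrr.
clearbody PA PB; pose E := invmx C *m A^T; pose F := B^T.
have EMF : E *m M *m F = 1%:M.
  rewrite /E /F defM !mulmxA -(mulmxA _ A^T) oA mulmx1 mulVmx // mul1mx.
  exact: oB.
(* Dividing the last rows by [t i] keeps the rank bound and makes the lower blocks
converge. *)
pose v i : 'M_(r + \rank G) :=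
  col_mx E ((t i)^-1 *: (L *m PA)) *m u i *m row_mx F (PB *m K).
pose w i := block_mx (E *m u i *m F) (E *m u i *m (PB *m K))
  (L *m PA *m ((t i)^-1 *: (u i - M)) *m F)
  (L *m PA *m ((t i)^-1 *: (u i - M)) *m (PB *m K)).
have vw i : v i = w i.
  rewrite /v /w mul_col_mx mul_col_row.
  have -> : (t i)^-1 *: (L *m PA) *m u i = L *m PA *m ((t i)^-1 *: (u i - M)).
    by rewrite -scalemxAr mulmxBr -(mulmxA L _ M) PAM mulmx0 subr0 -scalemxAl.
  by [].
have wlim : mxcvg w (block_mx 1%:M 0 (L *m PA *m Z *m F) 1%:M).
  have -> : 0 = E *m M *m (PB *m K).
    by rewrite mulmxA -(mulmxA E) MPB mulmx0 mul0mx.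
  rewrite -{1}EMF -LGK /G.
  have -> : L *m (PA *m Z *m PB) *m K = L *m PA *m Z *m (PB *m K).
    by rewrite !mulmxA.
  by apply: mxcvg_block; do ?[exact: mxcvg_cst | apply: mxcvg_mul].
have rk v0 : (\rank (v v0) <= k)%N.
  apply: leq_trans (mxrankM_maxl _ _) _; apply: leq_trans (mxrankM_maxr _ _) _.
  exact: rku.
rewrite leqNgt; apply/negP => lt.
have detw0 i : \det (w i) = 0.
  apply/eqP; rewrite -vw -[_ == 0]negbK -unitfE -unitmxE -row_free_unit.
  apply/negP => /eqP fr; move: (rk i); rewrite fr leqNgt.
  suff -> : (k < r + \rank G)%N by [].
  have : (k <= r + (k - r))%N by rewrite -leq_subLR.
  by move/leq_ltn_trans; apply; rewrite ltn_add2l.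
have h := mxcvg_det wlim; rewrite det_lblock !det1 mulr1 in h.
have h0 : (fun i => \det (w i)) @ \oo --> (0 : R).
  by under eq_cvg do rewrite detw0; exact: cvg_cst.
have : (1 : R) = 0.
  by rewrite -(cvg_lim (@Rhausdorff R) h) (cvg_lim (@Rhausdorff R) h0).
by move/eqP; rewrite oner_eq0.
Qed.

End Limits.

(** * Tensor-train ranks *)

Lemma rank_factor (F : fieldType) m n (M : 'M[F]_(m, n)) :
  exists (G : 'M_(m, \rank M)) (L : 'M_(\rank M, m)), M = G *m (L *m M).
Proof.
have /submxP[L defB] : (row_base M <= M)%MS by rewrite eq_row_base.
by exists (col_base M), L; rewrite -defB mulmx_base.
Qed.

Section TTRanks.
Context {R : realType} {n1 n2 n3 : nat}.
Implicit Types X : tensor R n1 n2 n3.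

Lemma has_ttd_rank X q1 q2 :
  has_ttd X q1 q2 -> (\rank (unfoldL X) <= q1)%N /\ (\rank (unfoldR X) <= q2)%N.
Proof.
case=> X1 [X2 [X3 ->]]; split.
  rewrite -contrLR unfoldL_contrL.
  exact: leq_trans (mxrankM_maxl _ _) (rank_leq_col _).
rewrite unfoldR_contrR.
exact: leq_trans (mxrankM_maxr _ _) (rank_leq_row _).
Qed.

Lemma has_ttd_rankL X q1 q2 : has_ttd X q1 q2 -> has_ttd X (\rank (unfoldL X)) q2.
Proof.
case=> X1 [X2 [X3 defX]]; have [G [L defM]] := rank_factor (unfoldL X).
move: (\rank _) G L defM => q G L defM; exists G, ((L *m X1) *L X2), X3.
rewrite /is_ttd -contrLA -[LHS]unfoldLK {1}defM -unfoldL_contrL -/(contrL G _).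
by rewrite defX !contrLR.
Qed.

Lemma has_ttd_rankR X q1 q2 : has_ttd X q1 q2 -> has_ttd X q1 (\rank (unfoldR X)).
Proof.
case=> X1 [X2 [X3 defX]]; have [G [L defM]] := rank_factor (unfoldR X)^T.
rewrite -mxrank_tr.
move: (\rank _) G L defM => q G L defM; exists X1, (X2 *R (X3 *m L^T)), G^T.
rewrite /is_ttd contrLR -contrRA -defX -[LHS]unfoldRK -{1}[unfoldR X]trmxK defM.
by rewrite !trmx_mul trmxK -unfoldR_contrR.
Qed.

(** Compressing the first factor to the column space of the left unfolding and the
last one to the row space of the right unfolding attains both lower bounds of
[has_ttd_rank] at once. *)
Lemma has_ttd_variety X k1 k2 : has_ttd X k1 k2 -> ttvariety k1 k2 X.
Proof.
move=> hX; have [le1 le2] := has_ttd_rank hX.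
exists (\rank (unfoldL X)), (\rank (unfoldR X)); split=> //.
split; first exact: has_ttd_rankR (has_ttd_rankL hX).
by move=> q1 q2; apply: has_ttd_rank.
Qed.

Lemma ttvariety_rank X k1 k2 :
  ttvariety k1 k2 X -> (\rank (unfoldL X) <= k1)%N /\ (\rank (unfoldR X) <= k2)%N.
Proof.
case=> r1 [r2 [[/has_ttd_rank[le1 le2] _] r1k r2k]].
by split; [apply: leq_trans r1k | apply: leq_trans r2k].
Qed.

Lemma ttrank_rank X r1 r2 :
  is_ttrank X r1 r2 -> (r1 <= \rank (unfoldL X))%N /\ (r2 <= \rank (unfoldR X))%N.
Proof.
case=> hX minX; split.
  by case: (minX _ _ (has_ttd_rankL hX)).
by case: (minX _ _ (has_ttd_rankR hX)).
Qed.

Lemma has_ttd_block r1 s1 r2 s2 (A1 : 'M[R]_(n1, r1)) (A2 : 'M[R]_(n1, s1))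
    (T11 : tensor R r1 n2 r2) (T12 : tensor R r1 n2 s2)
    (T21 : tensor R s1 n2 r2) (T22 : tensor R s1 n2 s2)
    (B1 : 'M[R]_(r2, n3)) (B2 : 'M[R]_(s2, n3)) :
  has_ttd (A1 *L T11 *R B1 + A1 *L T12 *R B2 + A2 *L T21 *R B1 + A2 *L T22 *R B2)
    (r1 + s1) (r2 + s2).
Proof.
exists (row_mx A1 A2),
  [ffun p => match split p.1.1, split p.2 with
             | inl i, inl k => T11 (i, p.1.2, k)
             | inl i, inr k => T12 (i, p.1.2, k)
             | inr i, inl k => T21 (i, p.1.2, k)
             | inr i, inr k => T22 (i, p.1.2, k)
             end], (col_mx B1 B2).
have splitl m n (i : 'I_m) : split (lshift n i) = inl i.
  exact: (unsplitK (inl i)).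
have splitr m n (i : 'I_n) : split (rshift m i) = inr i.
  exact: (unsplitK (inr i)).
apply/ffunP => -[[i j] k]; rewrite !tensorDE !contrRE big_split_ord /=.
rewrite -addrA addrACA; congr (_ + _); rewrite -big_split; apply: eq_bigr => l _ /=;
  rewrite !contrLE big_split_ord /= (col_mxEu, col_mxEd) -mulrDl; congr (_ * _);
  congr (_ + _); apply: eq_bigr => q _; rewrite ffunE ?row_mxEl ?row_mxEr /=;
  by rewrite ?splitl ?splitr.
Qed.

End TTRanks.

(** * The tangent cone *)

Section Cone.
Local Open Scope classical_set_scope.
Local Open Scope ring_scope.
Context {R : realType} {n1 n2 n3 : nat}.

Lemma tangent_coneZ (M : set (tensor R n1 n2 n3)) X Z (l : R) :
  0 < l -> tangent_cone M X Z -> tangent_cone M X (l *: Z).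
Proof.
move=> l_gt0 [u [t [t_gt0 t0 Mu uX uZ]]].
exists u, (fun i => t i / l); split=> //.
- by move=> i; apply: divr_gt0.
- by rewrite -[X in _ --> X](mul0r l^-1); apply: cvgM => //; apply: cvg_cst.
apply: tensor_cvg_of_entry => p; rewrite tensorZE.
under eq_cvg do rewrite invfM invrK mulrC -scalerA tensorZE.
apply: cvgM; [exact: cvg_cst | exact: tensor_cvg_entry uZ].
Qed.

(** Moving [Z] along its ray cannot decrease the distance to [Y], so the
derivative of the distance along the ray vanishes at [Z]; the inequality below is
the half of this obtained by shortening [Z]. *)
Lemma metric_projection_dot (M : set (tensor R n1 n2 n3)) X Y Z :
  metric_projection (tangent_cone M X) Y Z -> tdot Z Z <= tdot Y Z.
Proof.
case=> CZ minZ; rewrite leNgt; apply/negP => lt.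
have ZZ : 0 < tdot Z Z.
  rewrite lt_neqAle tdot_ge0 andbT; apply: contraTneq lt => /esym/tdot_eq0 ->.
  by rewrite !tdot0r ltxx.
(* A step for which the linear term outweighs the quadratic one. *)
pose e := Num.min (1 / 2) ((tdot Z Z - tdot Y Z) / tdot Z Z).
have e_gt0 : 0 < e.
  by rewrite lt_min; apply/andP; split; [lra | rewrite divr_gt0 // subr_gt0].
have e_lt1 : e <= 1 / 2 by rewrite ge_min lexx.
have e_le : e * tdot Z Z <= tdot Z Z - tdot Y Z.
  by rewrite -ler_pdivlMr // ge_min lexx orbT.
have := minZ _ (tangent_coneZ (_ : 0 < 1 - e) CZ).
rewrite !tnorm_sqr !tdotBl !tdotBr !tdotZl !tdotZr !(tdotC Z Y).
have e1 : 0 < 1 - e by lra.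
move/(_ e1); nra.
Qed.

Lemma cvg_addM0 (t v : nat -> R) (a l : R) :
  t @ \oo --> (0 : R) -> v @ \oo --> l -> (fun i => a + t i * v i) @ \oo --> a.
Proof.
move=> t0 vl; rewrite -[X in _ --> X]addr0 -[X in _ + X](mul0r l).
by apply: cvgD; [exact: cvg_cst | exact: cvgM].
Qed.

(** The curve obtained by moving all the blocks of a bordered decomposition at
once stays in the variety, and the six terms are the parts of its velocity at 0. *)
Lemma ttd_tangent r1 s1 r2 s2 (X : tensor R n1 n2 n3)
    (A dA : 'M[R]_(n1, r1)) (T dT : tensor R r1 n2 r2) (B dB : 'M[R]_(r2, n3))
    (U1 : 'M[R]_(n1, s1)) (V3 : 'M[R]_(s2, n3)) (U2 : tensor R r1 n2 s2)
    (V2 : tensor R s1 n2 r2) (Z2 : tensor R s1 n2 s2) :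
  X = A *L T *R B ->
  tangent_cone (ttvariety (r1 + s1) (r2 + s2)) X
    (dA *L T *R B + A *L T *R dB + A *L dT *R B
     + U1 *L V2 *R B + A *L U2 *R V3 + U1 *L Z2 *R V3).
Proof.
move=> defX; set Z := (X in tangent_cone _ _ X).
pose t (i : nat) : R := harmonic i.
have t_gt0 i : 0 < t i by exact: harmonic_gt0.
have t0 : t @ \oo --> (0 : R) by exact: cvg_harmonic.
pose c x := (A + x *: dA) *L (T + x *: dT) *R (B + x *: dB)
    + (A + x *: dA) *L (x *: U2) *R V3 + U1 *L (x *: V2) *R (B + x *: dB)
    + U1 *L (x *: Z2) *R V3.
pose Q := dA *L dT *R B + dA *L T *R dB + A *L dT *R dB
  + dA *L U2 *R V3 + U1 *L V2 *R dB.
pose K := dA *L dT *R dB.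
have cE (x : R) : c x = X + x *: (Z + x *: (Q + x *: K)).
  rewrite /c defX /Z /Q /K !(contrLDl, contrLDr, contrRDl, contrRDr).
  rewrite !(contrLZl, contrLZr, contrRZl, contrRZr).
  by apply/ffunP => p; rewrite !(tensorDE, tensorZE); ring.
exists (fun i => c (t i)), t; split=> //.
- by move=> i; apply: has_ttd_variety; rewrite /c; apply: has_ttd_block.
- apply: tensor_cvg_of_entry => p.
  under eq_cvg do rewrite cE !(tensorDE, tensorZE).
  apply: cvg_addM0 => //; apply: cvg_addM0 => //; apply: cvg_addM0 => //.
  exact: cvg_cst.
apply: tensor_cvg_of_entry => p.
have e i : ((t i)^-1 *: (c (t i) - X)) p = Z p + t i * (Q p + t i * K p).
  rewrite cE addrC addKr scalerA mulVf ?scale1r ?gt_eqF //.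
  by rewrite !(tensorDE, tensorZE).
under eq_cvg do rewrite e.
by apply: cvg_addM0 => //; apply: cvg_addM0 => //; apply: cvg_cst.
Qed.

End Cone.

(** * Projections attached to a bordered decomposition *)

Section Blocks.
Context {R : realType} {n1 n2 n3 r1 r2 : nat}.
Variables (X2'' : tensor R r1 n2 r2) (X3'' : 'M[R]_(r2, n3)).
Variables (X1' : 'M[R]_(n1, r1)) (X2' : tensor R r1 n2 r2).
Hypotheses (orthX2'' : stiefel (unfoldL X2'')^T) (orthX3'' : stiefel X3''^T).
Hypotheses (orthX1' : stiefel X1') (orthX2' : stiefel (unfoldR X2')).

Notation I2 := (1%:M : 'M[R]_n2).
Notation P1 := (Pj X1').
Notation P3 := (Pj X3''^T).

(** Orthogonal projectors onto the row space of the left unfolding of [X], and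
onto the complement of that space in the rows carried by [X3'']; then the same
two for the right unfolding. *)
Definition rowH : 'M[R]_(n3 * n2) := Pj (unfoldL (X2'' *R X3''))^T.
Definition rowG : 'M[R]_(n3 * n2) := P3 *t I2 - rowH.
Definition colH : 'M[R]_(n2 * n1) := Pj (unfoldR (X1' *L X2')).
Definition colG : 'M[R]_(n2 * n1) := I2 *t P1 - colH.

Lemma P1_proj : projmx P1. Proof. exact: projmx_stiefel. Qed.
Lemma P3_proj : projmx P3. Proof. exact: projmx_stiefel. Qed.

Lemma P1_X1 : P1 *m X1' = X1'.
Proof. by rewrite -mulmxA orthX1' mulmx1. Qed.

Lemma X3_P3 : X3'' *m P3 = X3''.
Proof.
have := orthX3''; rewrite /stiefel /= trmxK => o.
by rewrite /Pj trmxK mulmxA o mul1mx.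
Qed.

Lemma stiefel_rows : stiefel (unfoldL (X2'' *R X3''))^T.
Proof.
have := orthX3''; have := orthX2''; rewrite /stiefel /= !trmxK => o2 o3.
rewrite unfoldL_contrR trmx_mul mulmxA -(mulmxA (unfoldL _)) trmx_tens trmx1.
by rewrite tensmx_mul mulmx1 o3 tensmx1 mulmx1.
Qed.

Lemma stiefel_cols : stiefel (unfoldR (X1' *L X2')).
Proof.
rewrite /stiefel /= unfoldR_contrL trmx_mul mulmxA -(mulmxA (unfoldR _)^T).
by rewrite trmx_tens trmx1 tensmx_mul mulmx1 orthX1' tensmx1 mulmx1.
Qed.

Lemma tensr_proj n (P : 'M[R]_n) : projmx P -> projmx (P *t I2).
Proof.
by case=> sP iP; split; rewrite ?trmx_tens ?sP ?trmx1 // tensmx_mul iP mulmx1.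
Qed.

Lemma tensl_proj n (P : 'M[R]_n) : projmx P -> projmx (I2 *t P).
Proof.
by case=> sP iP; split; rewrite ?trmx_tens ?sP ?trmx1 // tensmx_mul iP mulmx1.
Qed.

Lemma rowH_proj : projmx rowH. Proof. exact/projmx_stiefel/stiefel_rows. Qed.
Lemma colH_proj : projmx colH. Proof. exact/projmx_stiefel/stiefel_cols. Qed.

Lemma rowH_P3 : rowH *m (P3 *t I2) = rowH.
Proof.
rewrite /rowH {1}/Pj trmxK -mulmxA unfoldL_contrR -[_ *m _ *m (_ *t _)]mulmxA.
by rewrite tensmx_mul X3_P3 mulmx1 /Pj trmxK.
Qed.

Lemma P1_colH : (I2 *t P1) *m colH = colH.
Proof.
rewrite /colH {2}/Pj unfoldR_contrL !mulmxA tensmx_mul P1_X1 mulmx1.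
by rewrite /Pj.
Qed.

Lemma colH_P1 : colH *m (I2 *t P1) = colH.
Proof.
have [s1 _] := tensl_proj P1_proj; have [s2 _] := colH_proj.
by rewrite -[LHS]trmxK trmx_mul s1 s2 P1_colH s2.
Qed.

Lemma rowG_facts :
  [/\ projmx rowG, rowH *m rowG = 0, rowG *m rowH = 0
    & rowG *m (P3 *t I2) = rowG].
Proof. exact: (projmx_sub (tensr_proj P3_proj) rowH_proj rowH_P3). Qed.

Lemma colG_facts :
  [/\ projmx colG, colH *m colG = 0, colG *m colH = 0
    & colG *m (I2 *t P1) = colG].
Proof. exact: (projmx_sub (tensl_proj P1_proj) colH_proj colH_P1). Qed.

Lemma P1_colG : (I2 *t P1) *m colG = colG.
Proof.
have [s1 _] := tensl_proj P1_proj; have [[s2 _] _ _ h] := colG_facts.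
by rewrite -[LHS]trmxK trmx_mul s1 s2 h s2.
Qed.

(** With [T := Y], the middle factor is the one used for [V2] and in [matA]. *)
Lemma ract_rowG (T : tensor R n1 n2 n3) :
  ract T rowG = foldL (unfoldL (T *R X3''^T) *m Pperp (unfoldL X2'')^T) *R X3''.
Proof.
rewrite -/(ract (T *R X3''^T) _) !contrR_ract !ractA; congr ract.
rewrite /rowG /rowH /Pperp /Pj !trmxK mulmxBl mul1mx mulmxBr tensmx_mul mulmx1.
congr (_ - _); rewrite unfoldL_contrR trmx_mul trmx_tens trmx1.
by rewrite !mulmxA.
Qed.

Lemma lact_colG (T : tensor R n1 n2 n3) :
  lact colG T = X1' *L foldR (Pperp (unfoldR X2') *m unfoldR (X1'^T *L T)).
Proof.
rewrite -/(lact _ (X1'^T *L T)) !contrL_lact !lactA; congr lact.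
rewrite /colG /colH /Pperp /Pj mulmxBr mulmx1 mulmxBl tensmx_mul mulmx1.
congr (_ - _); rewrite unfoldR_contrL trmx_mul trmx_tens trmx1.
by rewrite !mulmxA.
Qed.

(** A frame plays the role of the projector onto the column space of [U1], or of
the one onto the row space of [V3]. Working with projectors covers both the
orthonormal matrices computed by the algorithm and its square initial values. *)
Definition frame n r (X : 'M[R]_(n, r)) (P : 'M[R]_n) : Prop :=
  projmx P /\ P *m X = 0.

Lemma frame_mulPj n r (X : 'M[R]_(n, r)) P : frame X P -> P *m Pj X = 0.
Proof. by case=> _ PX; rewrite mulmxA PX mul0mx. Qed.

Lemma frame_Pjmul n r (X : 'M[R]_(n, r)) P :
  stiefel X -> frame X P -> Pj X *m P = 0.
Proof.
move=> oX fP; apply: projmx_mul0 (frame_mulPj fP); first by case: fP.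
exact: projmx_stiefel.
Qed.

Lemma frame_mulPperp n r (X : 'M[R]_(n, r)) P : frame X P -> P *m Pperp X = P.
Proof. by move=> fP; rewrite mulmxBr mulmx1 (frame_mulPj fP) subr0. Qed.

Lemma frame_Pperp n r (X : 'M[R]_(n, r)) : stiefel X -> frame X (Pperp X).
Proof.
move=> oX; split; first exact/projmx_compl/projmx_stiefel.
by rewrite mulmxBl mul1mx -mulmxA oX mulmx1 subrr.
Qed.

Lemma frame_stiefel n r s (X : 'M[R]_(n, r)) (U : 'M[R]_(n, s)) :
  stiefel U -> U^T *m X = 0 -> frame X (Pj U).
Proof.
by move=> oU UX; split; [exact: projmx_stiefel | rewrite -mulmxA UX mulmx0].
Qed.

Lemma projPerp1 : projmx (Pperp X1'). Proof. exact/projmx_compl/P1_proj. Qed.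
Lemma projPerp3 : projmx (Pperp X3''^T). Proof. exact/projmx_compl/P3_proj. Qed.

Section TangentProjector.
Variables (PU : 'M[R]_n1) (PV : 'M[R]_n3).
Hypotheses (fU : frame X1' PU) (fV : frame X3''^T PV).
Implicit Types T : tensor R n1 n2 n3.

Let partA T := Pperp X1' *L ract T rowH + PU *L ract T rowG.
Let partB T := lact colH (T *R Pperp X3''^T) + lact colG (T *R PV).
Let partC T := P1 *L (T *R P3).
Let partD T := PU *L (T *R PV).

Definition tangent_proj T := (partD T + partA T) + (partB T + partC T).

Let P3_PV : P3 *m PV = 0. Proof. exact: frame_Pjmul fV. Qed.
Let PU_P1 : PU *m P1 = 0. Proof. exact: frame_mulPj fU. Qed.

Let P3_perp : P3 *m Pperp X3''^T = 0.
Proof. by rewrite mulmxBr mulmx1; case: P3_proj => _ ->; rewrite subrr. Qed.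

Let P1_perp : Pperp X1' *m P1 = 0.
Proof. by rewrite mulmxBl mul1mx; case: P1_proj => _ ->; rewrite subrr. Qed.

Let opA : orthoproj partA.
Proof.
have [pG HG GH _] := rowG_facts.
apply: orthoproj_add => [||T].
- apply: orthoproj_comp => [||T]; first exact/contrL_orthoproj/projPerp1.
    exact/ract_orthoproj/rowH_proj.
  by rewrite contrL_ractC.
- apply: orthoproj_comp => [||T]; first by apply: contrL_orthoproj; case: fU.
    exact: ract_orthoproj.
  by rewrite contrL_ractC.
by rewrite -contrL_ractC ractA GH ract0 !contrL0.
Qed.

Let opB : orthoproj partB.
Proof.
have [pG HG GH _] := colG_facts.
apply: orthoproj_add => [||T].
- apply: orthoproj_comp => [||T]; first exact/lact_orthoproj/colH_proj.
    exact/contrR_orthoproj/projPerp3.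
  by rewrite lact_contrRC.
- apply: orthoproj_comp => [||T]; first exact/lact_orthoproj.
    by apply: contrR_orthoproj; case: fV.
  by rewrite lact_contrRC.
by rewrite -!lact_contrRC contrRA lactA HG lact0 contr0R.
Qed.

Let opC : orthoproj partC.
Proof.
apply: orthoproj_comp => [||T]; first exact/contrL_orthoproj/P1_proj.
  exact/contrR_orthoproj/P3_proj.
by rewrite contrLR.
Qed.

Let opD : orthoproj partD.
Proof.
apply: orthoproj_comp => [||T]; first by apply: contrL_orthoproj; case: fU.
  by apply: contrR_orthoproj; case: fV.
by rewrite contrLR.
Qed.

(* The blocks are told apart by the outer modes: [partA] and [partC] take values
in the range of [P3] in the third mode, [partB] and [partC] in that of [P1] in
the first, and each block kills the ranges that it does not use. *)
Let partA_P3 T : partA T = partA T *R P3.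
Proof.
have [_ _ _ G3] := rowG_facts.
rewrite /partA contrRDl -!contrLR !(contrR_ract _ P3) !ractA G3.
by rewrite rowH_P3.
Qed.

Let partC_P3 T : partC T = partC T *R P3.
Proof. by rewrite /partC -contrLR contrRA; case: P3_proj => _ ->. Qed.

Let partBC_P1 T : partB T + partC T = P1 *L (partB T + partC T).
Proof.
rewrite /partB /partC !contrLDr contrLA !(contrL_lact P1 (lact _ _)) !lactA.
rewrite P1_colH P1_colG; by case: P1_proj => _ ->.
Qed.

Let partD_P3 T : partD (T *R P3) = 0.
Proof. by rewrite /partD contrRA P3_PV contrR0 contrL0. Qed.

Let partB_P3 T : partB (T *R P3) = 0.
Proof.
by rewrite /partB !contrRA P3_PV P3_perp !contrR0 !lact0r addr0.
Qed.

Let partDA_P1 T : partD (P1 *L T) + partA (P1 *L T) = 0.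
Proof.
rewrite /partD /partA -contrLR -!contrL_ractC !contrLA PU_P1 P1_perp.
by rewrite !contr0L !addr0.
Qed.

Lemma tangent_orthoproj : orthoproj tangent_proj.
Proof.
apply: orthoproj_add => [||T].
- by apply: orthoproj_add => // T; rewrite partA_P3 partD_P3.
- by apply: orthoproj_add => // T; rewrite partC_P3 partB_P3.
by rewrite partBC_P1 partDA_P1.
Qed.

End TangentProjector.

(** * What the alternating algorithm increases *)

Section Gain.
Variable Y : tensor R n1 n2 n3.

Definition coreGain (PU : 'M[R]_n1) (PV : 'M[R]_n3) : R :=
  tdot Y (PU *L (Y *R PV)).
Definition leftGain (PU : 'M[R]_n1) : R := tdot Y (PU *L ract Y rowG).
Definition rightGain (PV : 'M[R]_n3) : R := tdot Y (lact colG (Y *R PV)).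

(** The part of the squared norm of [tangent_proj PU PV Y] that depends on the
frames; [fixedGain] is the rest. *)
Definition gain PU PV : R := coreGain PU PV + leftGain PU + rightGain PV.

Definition fixedGain : R :=
  tdot Y (Pperp X1' *L ract Y rowH) + tdot Y (lact colH (Y *R Pperp X3''^T))
  + tdot Y (P1 *L (Y *R P3)).

Lemma tangent_proj_dot PU PV :
  tdot Y (tangent_proj PU PV Y) = fixedGain + gain PU PV.
Proof.
by rewrite !tdotDr /fixedGain /gain /coreGain /leftGain /rightGain; ring.
Qed.

Lemma contrLR_orthoproj (P : 'M[R]_n1) (Q : 'M[R]_n3) :
  projmx P -> projmx Q ->
  orthoproj (fun T : tensor R n1 n2 n3 => P *L (T *R Q)).
Proof.
move=> pP pQ; apply: orthoproj_comp => [||T]; first exact: contrL_orthoproj.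
  exact: contrR_orthoproj.
by rewrite contrLR.
Qed.

Lemma contrL_ract_orthoproj (P : 'M[R]_n1) (N : 'M[R]_(n3 * n2)) :
  projmx P -> projmx N ->
  orthoproj (fun T : tensor R n1 n2 n3 => P *L ract T N).
Proof.
move=> pP pN; apply: orthoproj_comp => [||T]; first exact: contrL_orthoproj.
  exact: ract_orthoproj.
by rewrite contrL_ractC.
Qed.

Lemma lact_contrR_orthoproj (M : 'M[R]_(n2 * n1)) (Q : 'M[R]_n3) :
  projmx M -> projmx Q ->
  orthoproj (fun T : tensor R n1 n2 n3 => lact M (T *R Q)).
Proof.
move=> pM pQ; apply: orthoproj_comp => [||T]; first exact: lact_orthoproj.
  exact: contrR_orthoproj.
by rewrite lact_contrRC.
Qed.

Lemma rowG_proj : projmx rowG. Proof. by case: rowG_facts. Qed.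
Lemma colG_proj : projmx colG. Proof. by case: colG_facts. Qed.

Lemma fixedGain_ge0 : 0 <= fixedGain.
Proof.
rewrite /fixedGain !addr_ge0 //.
- exact: (orthoproj_dot_ge0 _ (contrL_ract_orthoproj projPerp1 rowH_proj)).
- exact: (orthoproj_dot_ge0 _ (lact_contrR_orthoproj colH_proj projPerp3)).
- exact: (orthoproj_dot_ge0 _ (contrLR_orthoproj P1_proj P3_proj)).
Qed.

Lemma leftGain_ge0 PU : projmx PU -> 0 <= leftGain PU.
Proof.
by move=> pU; exact: (orthoproj_dot_ge0 _ (contrL_ract_orthoproj pU rowG_proj)).
Qed.

Lemma rightGain_ge0 PV : projmx PV -> 0 <= rightGain PV.
Proof.
by move=> pV; exact: (orthoproj_dot_ge0 _ (lact_contrR_orthoproj colG_proj pV)).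
Qed.

Lemma frame_compl n r (X : 'M[R]_(n, r)) P :
  stiefel X -> frame X P -> projmx (Pperp X - P).
Proof.
move=> oX fP; case: (fP) => pP _.
have [|||//] := @projmx_sub _ _ (Pperp X) P.
- exact/projmx_compl/projmx_stiefel.
- exact: pP.
- exact: frame_mulPperp.
Qed.

(** The difference of the two gains is a sum of values of positive quadratic
forms, because [Pperp X3''^T - PV] is again a projector. *)
Lemma gain_le_right PU PV : frame X1' PU -> frame X3''^T PV ->
  gain PU PV <= gain PU (Pperp X3''^T).
Proof.
move=> fU fV; have pV := frame_compl orthX3'' fV; case: (fU) => pU _.
have c := orthoproj_dot_ge0 Y (contrLR_orthoproj pU pV).
have d := orthoproj_dot_ge0 Y (lact_contrR_orthoproj colG_proj pV).
rewrite contrRBr in c d.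
rewrite -scaleN1r contrLDr contrLZr scaleN1r tdotBr in c.
rewrite (orthoprojB _ _ (lact_orthoproj colG_proj)) tdotBr in d.
rewrite /gain /coreGain /rightGain; lra.
Qed.

Lemma gain_le_left PU PV : frame X1' PU -> frame X3''^T PV ->
  gain PU PV <= gain (Pperp X1') PV.
Proof.
move=> fU fV; have pU := frame_compl orthX1' fU; case: (fV) => pV _.
have c := orthoproj_dot_ge0 Y (contrLR_orthoproj pU pV).
have d := orthoproj_dot_ge0 Y (contrL_ract_orthoproj pU rowG_proj).
rewrite contrLBl tdotBr in c; rewrite contrLBl tdotBr in d.
rewrite /gain /coreGain /leftGain; lra.
Qed.

(** The matrix decomposed in the update of [U1] carries exactly the terms of the
gain that depend on the left frame. *)
Lemma matA_trace q (V : 'M[R]_(q, n3)) PU :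
  frame X3''^T (Pj V^T) -> frame X1' PU ->
  \tr ((matA Y X2'' X3'' X1' V)^T *m PU *m matA Y X2'' X3'' X1' V)
  = coreGain PU (Pj V^T) + leftGain PU.
Proof.
move=> fV fU; set A := matA _ _ _ _ _; set PV := Pj V^T in fV *.
have [pU _] := fU; have [sU iU] := pU; have [pV _] := fV.
have [_ _ _ G3] := rowG_facts.
pose K (T : tensor R n1 n2 n3) := T *R PV + ract T rowG.
have pK : orthoproj K.
  apply: orthoproj_add => [||T]; first exact: contrR_orthoproj.
    exact/ract_orthoproj/rowG_proj.
  rewrite -G3 -ractA -contrR_ract contrRA.
  by rewrite (frame_Pjmul orthX3'' fV) contrR0.
have defA : A = Pperp X1' *m unfoldL (K Y).
  by rewrite /A /matA /K unfoldLD ract_rowG (unfoldL_contrR _ X3'') foldLK.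
have UA : PU *m A = unfoldL (PU *L K Y).
  by rewrite defA mulmxA (frame_mulPperp fU) unfoldL_contrL.
have pUK : orthoproj (fun T => PU *L K T).
  apply: orthoproj_comp => // [|T]; first exact: contrL_orthoproj.
  by rewrite /K contrLDr contrLR contrL_ractC.
have -> : \tr (A^T *m PU *m A) = tdot (PU *L K Y) (PU *L K Y).
  rewrite tdot_unfoldL -UA [in RHS]mxtrace_mulC (trmx_mul PU A) sU !mulmxA.
  by rewrite -(mulmxA _ PU PU) iU.
by rewrite (orthoproj_dot _ pUK) /K contrLDr tdotDr.
Qed.

Lemma matB_trace q (U : 'M[R]_(n1, q)) PV :
  frame X1' (Pj U) -> frame X3''^T PV ->
  \tr (matB Y X3'' X1' X2' U *m PV *m (matB Y X3'' X1' X2' U)^T)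
  = coreGain (Pj U) PV + rightGain PV.
Proof.
move=> fU fV; set B := matB _ _ _ _ _; set PU := Pj U in fU *.
have [pU _] := fU; have [pV _] := fV; have [sV iV] := pV.
pose K (T : tensor R n1 n2 n3) := PU *L T + lact colG T.
have pK : orthoproj K.
  apply: orthoproj_add => [||T]; first exact: contrL_orthoproj.
    exact/lact_orthoproj/colG_proj.
  rewrite -P1_colG -lactA -contrL_lact contrLA.
  by rewrite (frame_mulPj fU) contr0L.
have defB : B = unfoldR (K Y) *m Pperp X3''^T.
  by rewrite /B /matB /K unfoldRD lact_colG (unfoldR_contrL X1') foldRK !mulmxA.
have BV : B *m PV = unfoldR (K Y *R PV).
  rewrite defB -mulmxA unfoldR_contrR; congr (_ *m _).
  by rewrite mulmxBl mul1mx (frame_Pjmul orthX3'' fV) subr0.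
have pKV : orthoproj (fun T => K (T *R PV)).
  apply: orthoproj_comp => // [|T]; first exact: contrR_orthoproj.
  by rewrite /K contrRDl contrLR lact_contrRC.
have KV : K Y *R PV = K (Y *R PV) by rewrite /K contrRDl contrLR lact_contrRC.
have -> : \tr (B *m PV *m B^T) = tdot (K (Y *R PV)) (K (Y *R PV)).
  rewrite -KV tdot_unfoldR -BV [in RHS]mxtrace_mulC (trmx_mul B PV) sV !mulmxA.
  by rewrite -(mulmxA _ PV PV) iV.
by rewrite (orthoproj_dot _ pKV) /K tdotDr.
Qed.

End Gain.
End Blocks.

(** * The iterations of the algorithm *)

Section Iterations.
Context {R : realType} {n1 n2 n3 r1 r2 : nat}.
Variables (Y : tensor R n1 n2 n3).
Variables (X2'' : tensor R r1 n2 r2) (X3'' : 'M[R]_(r2, n3)).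
Variables (X1' : 'M[R]_(n1, r1)) (X2' : tensor R r1 n2 r2).
Hypotheses (orthX2'' : stiefel (unfoldL X2'')^T) (orthX3'' : stiefel X3''^T).
Hypotheses (orthX1' : stiefel X1') (orthX2' : stiefel (unfoldR X2')).
Variables (s1 s2 : nat).
Hypotheses (r1_lt : (r1 < n1)%N) (r2_lt : (r2 < n3)%N).
Hypotheses (s1_le : (s1 <= n1 - r1)%N) (s2_le : (s2 <= n3 - r2)%N).

Let coreGain := coreGain Y.
Let leftGain := leftGain X2'' X3'' Y.
Let rightGain := rightGain X1' X2' Y.
Let gain := gain X2'' X3'' X1' X2' Y.
Let perp1 := Pperp X1'.
Let perp3 := Pperp X3''^T.

Lemma trace_Pj n s (U : 'M[R]_(n, s)) : stiefel U -> \tr (Pj U) = s%:R.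
Proof. by move=> oU; rewrite mxtrace_mulC oU mxtrace1. Qed.

Lemma trace_Pperp n r (X : 'M[R]_(n, r)) :
  stiefel X -> (r < n)%N -> \tr (Pperp X) = (n - r)%:R.
Proof.
by move=> oX rn; rewrite linearB /= mxtrace1 trace_Pj // natrB // ltnW.
Qed.

Lemma svdA_gain q (V : 'M[R]_(q, n3)) (U' : 'M[R]_(n1, s1)) S :
  frame X3''^T (Pj V^T) -> svdA Y X2'' X3'' X1' V U' S ->
  [/\ frame X1' (Pj U'), \tr (Pj U') = s1%:R &
    forall P c, frame X1' P -> 0 <= c <= 1 -> c * \tr P <= s1%:R ->
      c * (coreGain P (Pj V^T) + leftGain P)
      <= coreGain (Pj U') (Pj V^T) + leftGain (Pj U')].
Proof.
move=> fV [[W svd] rk]; have oU := truncated_svd_stiefel svd.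
have XA : X1'^T *m matA Y X2'' X3'' X1' V = 0.
  by rewrite mulmxA mulmxBr mulmx1 mulmxA orthX1' mul1mx subrr mul0mx.
have fU := frame_stiefel oU (truncated_svd_orth svd XA rk).
split=> // [|P c fP c01 mass]; first exact: trace_Pj.
have := truncated_svd_max svd (proj1 fP) c01 mass.
by rewrite !matA_trace.
Qed.

Lemma svdB_gain q (U : 'M[R]_(n1, q)) (V' : 'M[R]_(s2, n3)) S :
  frame X1' (Pj U) -> svdB Y X3'' X1' X2' U S V' ->
  [/\ frame X3''^T (Pj V'^T), \tr (Pj V'^T) = s2%:R &
    forall P c, frame X3''^T P -> 0 <= c <= 1 -> c * \tr P <= s2%:R ->
      c * (coreGain (Pj U) P + rightGain P)
      <= coreGain (Pj U) (Pj V'^T) + rightGain (Pj V'^T)].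
Proof.
move=> fU [[W /truncated_svd_tr svd] rk]; have oV := truncated_svd_stiefel svd.
set B := matB _ _ _ _ _ in svd rk.
have XB : (X3''^T)^T *m B^T = 0.
  have [_ PX] := frame_Pperp orthX3''.
  by rewrite -trmx_mul /B /matB -(mulmxA _ (Pperp X3''^T)) PX mulmx0 trmx0.
have rk' : (\rank B^T < s2)%N -> V'^T^T *m X3''^T = 0 by rewrite mxrank_tr trmxK.
have fV := frame_stiefel oV (truncated_svd_orth svd XB rk').
split=> // [|P c fP c01 mass]; first exact: trace_Pj.
have := truncated_svd_max svd (proj1 fP) c01 mass.
by rewrite trmxK !matB_trace.
Qed.

Let gainE PU PV : gain PU PV = coreGain PU PV + leftGain PU + rightGain PV.
Proof. by []. Qed.

Let w1 : R := s1%:R / (n1 - r1)%:R.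
Let w2 : R := s2%:R / (n3 - r2)%:R.

Lemma ratio01 (s m : nat) :
  (0 < m)%N -> (s <= m)%N -> 0 <= (s%:R / m%:R : R) <= 1.
Proof.
move=> m_gt0 sm; rewrite divr_ge0 ?ler0n //=.
by rewrite ler_pdivrMr ?ltr0n // mul1r ler_nat.
Qed.

Lemma ratio_trace n r s (X : 'M[R]_(n, r)) : stiefel X -> (r < n)%N ->
  s%:R / (n - r)%:R * \tr (Pperp X) <= s%:R :> R.
Proof.
move=> oX rn; rewrite trace_Pperp // divfK // pnatr_eq0 -lt0n subn_gt0 //.
Qed.

(** The pairs of frames among which the best gain is a bound for the projection
onto the tangent cone. *)
Definition admissible (PU : 'M[R]_n1) (PV : 'M[R]_n3) : Prop :=
  [/\ frame X1' PU, frame X3''^T PV, \tr PU <= s1%:R & \tr PV <= s2%:R].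

Definition near_optimal (PU : 'M[R]_n1) (PV : 'M[R]_n3) : Prop :=
  admissible PU PV /\
  forall QU QV, admissible QU QV -> Num.max w1 w2 * gain QU QV <= gain PU PV.

(** In the first pass the matrix that is not yet updated stands for the whole
complement. The first update is then at least as good as any admissible pair,
because restricting the other frame cannot increase the gain; the second one
loses at most the average factor, which is the larger one by the choice of the
order. In later passes no update decreases the gain. *)
Lemma body_near_optimal q1 q2 (U : 'M[R]_(n1, q1)) (V : 'M[R]_(q2, n3))
    U' V' eta' :
  (Pj U = perp1 /\ Pj V^T = perp3) \/ near_optimal (Pj U) (Pj V^T) ->
  body Y X2'' X3'' X1' X2' U V U' V' eta' ->
  near_optimal (Pj (U' : 'M[R]_(n1, s1))) (Pj (V' : 'M[R]_(s2, n3))^T).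
Proof.
have w1_01 : 0 <= w1 <= 1 by rewrite ratio01 ?subn_gt0.
have w2_01 : 0 <= w2 <= 1 by rewrite ratio01 ?subn_gt0.
have one01 : 0 <= (1 : R) <= 1 by rewrite ler01 lexx.
have fp1 : frame X1' perp1 by exact: frame_Pperp.
have fp3 : frame X3''^T perp3 by exact: frame_Pperp.
move=> start.
have [fU fV] : frame X1' (Pj U) /\ frame X3''^T (Pj V^T).
  by case: start => [[-> ->]//|[[]]].
rewrite /body -/w1 -/w2; case: ltP => [w_lt|w_le].
  case=> [[S1 /(svdA_gain fV)[fU' tU' maxU]]].
  case=> [S2 [/(svdB_gain fU')[fV' tV' maxV] _]].
  split=> [|QU QV adQ]; first by split=> //; rewrite ?tU' ?tV'.
  rewrite max_r ?(ltW w_lt) //; case: start => [[_ V0]|[[_ _ tU tV] opt]].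
    have [fQU fQV tQU _] := adQ; rewrite V0 in maxU.
    have h1 : gain QU QV <= gain QU perp3 by exact: gain_le_right.
    have h2 : 1 * _ <= _ := maxU QU 1 fQU one01 _; rewrite !mul1r in h2.
    have {}h2 := h2 tQU.
    have h3 := maxV perp3 w2 fp3 w2_01 (ratio_trace _ orthX3'' r2_lt).
    have h4 : w2 * leftGain (Pj U') <= leftGain (Pj U').
      by rewrite ler_piMl ?leftGain_ge0 //; case/andP: w2_01 => //; case: fU'.
    have h5 : w2 * gain QU QV
        <= w2 * (coreGain (Pj U') perp3 + leftGain (Pj U') + rightGain perp3).
      rewrite ler_wpM2l //; first by case/andP: w2_01.
      by apply: le_trans h1 _; rewrite lerD2r.
    apply: le_trans h5 _; rewrite gainE; lra.
  have h2 : 1 * _ <= _ := maxU _ 1 fU one01 _; rewrite !mul1r in h2.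
  have h3 : 1 * _ <= _ := maxV _ 1 fV one01 _; rewrite !mul1r in h3.
  have := opt _ _ adQ; rewrite max_r ?(ltW w_lt) // => /le_trans; apply.
  by have := h2 tU; have := h3 tV; rewrite !gainE; lra.
case=> [[S1 /(svdB_gain fU)[fV' tV' maxV]]].
case=> [S2 [/(svdA_gain fV')[fU' tU' maxU] _]].
split=> [|QU QV adQ]; first by split=> //; rewrite ?tU' ?tV'.
rewrite max_l //; case: start => [[U0 _]|[[_ _ tU tV] opt]].
  have [fQU fQV _ tQV] := adQ; rewrite U0 in maxV.
  have h1 : gain QU QV <= gain perp1 QV by exact: gain_le_left.
  have h2 : 1 * _ <= _ := maxV QV 1 fQV one01 _; rewrite !mul1r in h2.
  have {}h2 := h2 tQV.
  have h3 := maxU perp1 w1 fp1 w1_01 (ratio_trace _ orthX1' r1_lt).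
  have h4 : w1 * rightGain (Pj V'^T) <= rightGain (Pj V'^T).
    by rewrite ler_piMl ?rightGain_ge0 //; case/andP: w1_01 => //; case: fV'.
  have h5 : w1 * gain QU QV
      <= w1 * (coreGain perp1 (Pj V'^T) + leftGain perp1 + rightGain (Pj V'^T)).
    rewrite ler_wpM2l //; first by case/andP: w1_01.
    by apply: le_trans h1 _; rewrite gainE; lra.
  apply: le_trans h5 _; rewrite gainE; lra.
have h2 : 1 * _ <= _ := maxV _ 1 fV one01 _; rewrite !mul1r in h2.
have h3 : 1 * _ <= _ := maxU _ 1 fU one01 _; rewrite !mul1r in h3.
have := opt _ _ adQ; rewrite max_l // => /le_trans; apply.
by have := h2 tV; have := h3 tU; rewrite !gainE; lra.
Qed.

(** An output that precedes every update would be the initial state, where the loop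
guard holds because the difference of the two etas is infinite. *)
Lemma algorithm_output_near_optimal (eps : R) (imax : nat)
    (U1 : 'M[R]_(n1, s1)) (V3 : 'M[R]_(s2, n3)) :
  (1 <= imax)%N -> algorithm_output Y X2'' X3'' X1' X2' eps imax U1 V3 ->
  near_optimal (Pj U1) (Pj V3^T).
Proof.
move=> imax_gt0 [i [eta1 [eta2 [reach stop]]]].
suff inv : forall j e1 e2 q1 q2 (U : 'M[R]_(n1, q1)) (V : 'M[R]_(q2, n3)),
    @reachable R n1 n2 n3 r1 r2 Y X2'' X3'' X1' X2' s1 s2 eps imax
      j e1 e2 q1 q2 U V ->
    [/\ j = 0%N, e1 = 0%E, e2 = +oo%E & Pj U = perp1 /\ Pj V^T = perp3]
    \/ near_optimal (Pj U) (Pj V^T).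
  case: (inv _ _ _ _ _ _ _ reach) => // -[j0 e10 e20 _].
  by move: stop; rewrite /loop_guard j0 e10 e20 imax_gt0 sube0 /= ltry.
move=> j e1 e2 q1 q2 U V.
elim=> [|{}j {}e1 {}e2 {}q1 {}q2 {}U {}V U' V' eta' _ IH _ step].
  left; split=> //; split; first exact/Pj_projmx/projPerp1.
  case: (projPerp3 orthX3'') => sP _; rewrite sP; exact/Pj_projmx/projPerp3.
right; apply: body_near_optimal step.
by case: IH => [[_ _ _ ?]|?]; [left | right].
Qed.

End Iterations.

(** * Tangent vectors are fixed by some projection *)

Section TangentVectors.
Context {R : realType} {n1 n2 n3 r1 r2 : nat}.
Variables (X2'' : tensor R r1 n2 r2) (X3'' : 'M[R]_(r2, n3)).
Variables (X1' : 'M[R]_(n1, r1)) (X2' : tensor R r1 n2 r2).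
Hypotheses (orthX2'' : stiefel (unfoldL X2'')^T) (orthX3'' : stiefel X3''^T).
Hypotheses (orthX1' : stiefel X1') (orthX2' : stiefel (unfoldR X2')).

Notation I2 := (1%:M : 'M[R]_n2).
Notation rH := (rowH X2'' X3'').
Notation rG := (rowG X2'' X3'').
Notation cH := (colH X1' X2').
Notation cG := (colG X1' X2').

(** The two fixed-point hypotheses are what the rank conditions on a tangent
vector give. The component of [Z] orthogonal to [X] in both outer modes appears in
both, which is why it is reduced to [PU] and [PV] at once. *)
Lemma tangent_proj_id PU PV (Z : tensor R n1 n2 n3) :
  frame X1' PU -> frame X3''^T PV ->
  PU *m (Pperp X1' *m unfoldL Z *m (1%:M - rH))
    = Pperp X1' *m unfoldL Z *m (1%:M - rH) ->
  (1%:M - cH) *m unfoldR Z *m Pperp X3''^T *m PV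
    = (1%:M - cH) *m unfoldR Z *m Pperp X3''^T ->
  tangent_proj X2'' X3'' X1' X2' PU PV Z = Z.
Proof.
move=> fU fV; rewrite !mulmxA (frame_mulPperp fU) => fixU.
have PV_perp : Pperp X3''^T *m PV = PV.
  by rewrite mulmxBl mul1mx (frame_Pjmul orthX3'' fV) subr0.
rewrite -(mulmxA _ _ PV) PV_perp => fixV.
have HU (N : 'M_(n3 * n2)) :
    rH *m N = 0 -> PU *L ract Z N = Pperp X1' *L ract Z N.
  move=> HN; have N1 : N = (1%:M - rH) *m N by rewrite mulmxBl mul1mx HN subr0.
  by rewrite N1 /contrL /ract !foldLK !mulmxA fixU.
have HV (M : 'M_(n2 * n1)) :
    M *m cH = 0 -> lact M (Z *R PV) = lact M (Z *R Pperp X3''^T).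
  move=> MH; have M1 : M = M *m (1%:M - cH) by rewrite mulmxBr mulmx1 MH subr0.
  by rewrite M1 /contrR /lact !foldRK -!(mulmxA M) !(mulmxA (1%:M - cH)) fixV.
have [_ HG _ _] := rowG_facts orthX2'' orthX3''.
have [_ _ GH _] := colG_facts orthX1' orthX2'.
have e4 : PU *L (Z *R PV) = Pperp X1' *L (Z *R Pperp X3''^T).
  have H3 : rH *m (Pperp X3''^T *t I2) = 0.
    rewrite -(rowH_P3 _ orthX3'') -mulmxA tensmx_mul.
    by rewrite (frame_Pjmul orthX3'' (frame_Pperp orthX3'')) tens0mx mulmx0.
  have H1 : (I2 *t Pperp X1') *m cH = 0.
    rewrite -(P1_colH _ orthX1') mulmxA tensmx_mul.
    by rewrite (frame_mulPj (frame_Pperp orthX1')) tensmx0 mul0mx.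
  rewrite -{1}(frame_mulPperp fU) -contrLA (contrL_lact _ (Z *R _)) HV //.
  by rewrite -contrL_lact contrLA (frame_mulPperp fU) contrR_ract HU.
have eA : Pperp X1' *L ract Z rH + PU *L ract Z rG
    = Pperp X1' *L (Z *R Pj X3''^T).
  by rewrite HU // -contrLDr -ractDr /rowG addrC subrK -contrR_ract.
have eB : lact cH (Z *R Pperp X3''^T) + lact cG (Z *R PV)
    = Pj X1' *L (Z *R Pperp X3''^T).
  by rewrite HV // -lactDl /colG addrC subrK -contrL_lact.
rewrite /tangent_proj e4 eA eB -!contrLDr -!contrRDr !subrK contr1R.
by rewrite -contrLDl subrK contr1L.
Qed.

End TangentVectors.


Section CommonCore.
Context {R : realType} {n1 n2 n3 r1 r2 : nat}.
Variables (X : tensor R n1 n2 n3) (X1 : 'M[R]_(n1, r1)) (X3 : 'M[R]_(r2, n3)).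
Variables (X2'' : tensor R r1 n2 r2) (X3'' : 'M[R]_(r2, n3)).
Variables (X1' : 'M[R]_(n1, r1)) (X2' : tensor R r1 n2 r2).
Hypotheses (rankX : is_ttrank X r1 r2).
Hypotheses (ttdR : is_ttd X X1 X2'' X3'') (ttdL : is_ttd X X1' X2' X3).
Hypotheses (orthX2'' : stiefel (unfoldL X2'')^T) (orthX3'' : stiefel X3''^T).
Hypotheses (orthX1' : stiefel X1') (orthX2' : stiefel (unfoldR X2')).

(** The two decompositions of [X] have the same outer column and row spaces, so
they differ by two square changes of basis. *)
Let C := X1'^T *m X1.
Let D := X3 *m X3''^T.

Lemma ttd_changeL : X = X1' *L (C *L X2'') *R X3''.
Proof.
have PX : Pj X1' *L X = X by rewrite ttdL contrLR contrLA P1_X1.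
by rewrite -[LHS]PX ttdR contrLR !contrLA /C /Pj mulmxA.
Qed.

Lemma ttd_changeR : X = X1' *L (X2' *R D) *R X3''.
Proof.
have PX : X *R Pj X3''^T = X by rewrite ttdR contrRA X3_P3.
by rewrite -[LHS]PX ttdL contrLR !contrRA /D /Pj trmxK mulmxA.
Qed.

Lemma ttd_core : C *L X2'' = X2' *R D.
Proof.
have o3 : X3'' *m X3''^T = 1%:M by have := orthX3''; rewrite /stiefel /= trmxK.
have cut (T : tensor R r1 n2 r2) : X1'^T *L (X1' *L T *R X3'') *R X3''^T = T.
  by rewrite contrLR contrLA contrRA o3 orthX1' contr1L contr1R.
by rewrite -[LHS]cut -ttd_changeL ttd_changeR cut.
Qed.

Lemma unfoldL_X : unfoldL X = X1' *m C *m unfoldL (X2'' *R X3'').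
Proof. by rewrite {1}ttd_changeL -contrLR -contrLR contrLA unfoldL_contrL. Qed.

Lemma unfoldR_X : unfoldR X = unfoldR (X1' *L X2') *m D *m X3''.
Proof. by rewrite {1}ttd_changeR contrLR contrRA unfoldR_contrR mulmxA. Qed.

(** Minimality of (r1, r2) is what makes the changes of basis invertible. *)
Lemma C_unit : C \in unitmx.
Proof.
have [le _] := ttrank_rank rankX.
rewrite -row_free_unit /row_free eqn_leq rank_leq_row.
apply: leq_trans le _; rewrite unfoldL_X.
by apply: leq_trans (mxrankM_maxl _ _) _; apply: mxrankM_maxr.
Qed.

Lemma D_unit : D \in unitmx.
Proof.
have [_ le] := ttrank_rank rankX.
rewrite -row_free_unit /row_free eqn_leq rank_leq_row.
apply: leq_trans le _; rewrite unfoldR_X.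
by apply: leq_trans (mxrankM_maxl _ _) _; apply: mxrankM_maxr.
Qed.

Lemma tangent_cone_fixed k1 k2 Z : tangent_cone (ttvariety k1 k2) X Z ->
  exists PU PV, admissible X3'' X1' (k1 - r1) (k2 - r2) PU PV
    /\ tangent_proj X2'' X3'' X1' X2' PU PV Z = Z.
Proof.
case=> u [t [t_gt0 t0 Mu uX uZ]].
have o3 : X3'' *m X3''^T = 1%:M by have := orthX3''; rewrite /stiefel /= trmxK.
have oB := stiefel_rows orthX2'' orthX3''; rewrite /stiefel /= trmxK in oB.
have oA := stiefel_cols orthX1' orthX2'.
set M := Pperp X1' *m unfoldL Z *m (1%:M - rowH X2'' X3'').
set N := (1%:M - colH X1' X2') *m unfoldR Z *m Pperp X3''^T.
have rkM : (\rank M <= k1 - r1)%N.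
  have -> : M = (1%:M - X1' *m X1'^T) *m unfoldL Z
      *m (1%:M - (unfoldL (X2'' *R X3''))^T *m unfoldL (X2'' *R X3'')).
    by rewrite /M /rowH /Pperp /Pj trmxK.
  apply: (determinantal_tangent_rank unfoldL_X orthX1' oB C_unit t_gt0
    (u := fun i => unfoldL (u i))) => [i|i l|i l].
  - by case: (ttvariety_rank (Mu i)).
  - by rewrite mxE; under eq_cvg do rewrite mxE; apply: tensor_cvg_entry.
  - rewrite [unfoldL Z _ _]mxE; under eq_cvg do rewrite -unfoldLB -unfoldLZ mxE.
    exact: tensor_cvg_entry uZ.
have rkN : (\rank N <= k2 - r2)%N.
  have -> : N = (1%:M - unfoldR (X1' *L X2') *m (unfoldR (X1' *L X2'))^T)
      *m unfoldR Z *m (1%:M - X3''^T *m X3'').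
    by rewrite /N /colH /Pperp /Pj trmxK.
  apply: (determinantal_tangent_rank unfoldR_X oA o3 D_unit t_gt0
    (u := fun i => unfoldR (u i))) => [i|l k|l k].
  - by case: (ttvariety_rank (Mu i)).
  - by rewrite mxE; under eq_cvg do rewrite mxE; apply: tensor_cvg_entry.
  - rewrite [unfoldR Z _ _]mxE; under eq_cvg do rewrite -unfoldRB -unfoldRZ mxE.
    exact: tensor_cvg_entry uZ.
have [PU [pU UM tU kU]] := colspace_projmx M.
have [PV [pV VN tV kV]] := colspace_projmx N^T.
have fU : frame X1' PU.
  have XP : X1'^T *m Pperp X1' = 0.
    by rewrite mulmxBr mulmx1 mulmxA orthX1' mul1mx subrr.
  by split=> //; apply: kU; rewrite /M !mulmxA XP !mul0mx.
have fV : frame X3''^T PV.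
  split=> //; apply: kV; rewrite -trmx_mul /N -(mulmxA _ (Pperp _)).
  by have [_ ->] := frame_Pperp orthX3''; rewrite mulmx0 trmx0.
exists PU, PV; split.
  by split=> //; rewrite ?tU ?tV ?mxrank_tr ler_nat.
apply: tangent_proj_id => //.
by case: (pV) => sV _; rewrite -[LHS]trmxK trmx_mul sV VN trmxK.
Qed.

End CommonCore.

(** * The angle condition *)

Section Terms.
Context {R : realType} {n1 n2 n3 r1 r2 : nat}.
Variables (Y : tensor R n1 n2 n3).
Variables (X2'' : tensor R r1 n2 r2) (X3'' : 'M[R]_(r2, n3)).
Variables (X1' : 'M[R]_(n1, r1)) (X2' : tensor R r1 n2 r2).

Lemma row_term (P : 'M[R]_n1) :
  (P *m unfoldL (Y *R X3''^T) *m (unfoldL X2'')^T) *L X2'' *R X3''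
  = P *L ract Y (rowH X2'' X3'').
Proof.
rewrite -mulmxA -contrLA -contrLR; congr contrL.
rewrite -contrLR /contrL /ract /rowH /Pj trmxK; congr foldL.
rewrite [in RHS]unfoldL_contrR !unfoldL_contrR trmx_mul trmx_tens trmx1.
by rewrite !mulmxA.
Qed.

Lemma col_term (P : 'M[R]_n3) :
  X1' *L X2' *R ((unfoldR X2')^T *m unfoldR (X1'^T *L Y) *m P)
  = lact (colH X1' X2') (Y *R P).
Proof.
rewrite -contrRA -lact_contrRC; congr contrR.
rewrite /contrR /lact /colH /Pj; congr foldR.
by rewrite !unfoldR_contrL trmx_mul trmx_tens trmx1 !mulmxA.
Qed.

End Terms.

Theorem theorem1 (R : realType) (n1 n2 n3 r1 r2 k1 k2 : nat)
    (X : tensor R n1 n2 n3)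
    (X1 : 'M[R]_(n1, r1)) (X2'' : tensor R r1 n2 r2) (X3'' : 'M[R]_(r2, n3))
    (X1' : 'M[R]_(n1, r1)) (X2' : tensor R r1 n2 r2) (X3 : 'M[R]_(r2, n3))
    (rankX : is_ttrank X r1 r2)
    (r1_le_k1 : (r1 <= k1)%N) (k1_le_n1 : (k1 <= n1)%N)
    (r2_le_k2 : (r2 <= k2)%N) (k2_le_n3 : (k2 <= n3)%N)
    (r1_lt_n1 : (r1 < n1)%N) (r2_lt_n3 : (r2 < n3)%N)
    (r_neq_k : (r1, r2) <> (k1, k2))
    (ttdR : is_ttd X X1 X2'' X3'') (ttdL : is_ttd X X1' X2' X3)
    (orthX2'' : stiefel (unfoldL X2'')^T) (orthX3'' : stiefel X3''^T)
    (orthX1' : stiefel X1') (orthX2' : stiefel (unfoldR X2'))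
    (Y : tensor R n1 n2 n3) (eps : R) (eps_gt0 : 0 < eps)
    (imax : nat) (imax_ge1 : (1 <= imax)%N)
    (U1 : 'M[R]_(n1, k1 - r1)) (V3 : 'M[R]_(k2 - r2, n3))
    (outUV : algorithm_output Y X2'' X3'' X1' X2' eps imax U1 V3) :
  let W1 := Pperp X1' *m unfoldL (Y *R X3''^T) *m (unfoldL X2'')^T in
  let W3 := (unfoldR X2')^T *m unfoldR (X1'^T *L Y) *m Pperp X3''^T in
  let U2 := foldR (Pperp (unfoldR X2') *m unfoldR (X1'^T *L Y)) *R V3^T in
  let W2 := X1'^T *L Y *R X3''^T in
  let V2 := U1^T *L foldL (unfoldL (Y *R X3''^T) *m Pperp (unfoldL X2'')^T) in
  let Z2 := U1^T *L Y *R V3^T in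
  let Ytilde := W1 *L X2'' *R X3'' + X1' *L X2' *R W3 + X1' *L W2 *R X3''
              + U1 *L V2 *R X3'' + X1' *L U2 *R V3 + U1 *L Z2 *R V3 in
  let omega := Num.sqrt (Num.max ((k1 - r1)%:R / (n1 - r1)%:R)
                                 ((k2 - r2)%:R / (n3 - r2)%:R)) : R in
  let TX := tangent_cone (ttvariety k1 k2) X in
  TX Ytilde /\
  forall Yhat : tensor R n1 n2 n3, metric_projection TX Y Yhat ->
    tdot Y Ytilde >= omega * tnorm Yhat * tnorm Ytilde.
Proof.
set c1 := _ / (n1 - r1)%:R; set c2 := _ / (n3 - r2)%:R.
move=> W1 W3 U2 W2 V2 Z2 Ytilde omega TX.
have s1_le : (k1 - r1 <= n1 - r1)%N by exact: leq_sub2r.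
have s2_le : (k2 - r2 <= n3 - r2)%N by exact: leq_sub2r.
have [admUV opt] := algorithm_output_near_optimal orthX2'' orthX3'' orthX1'
  orthX2' r1_lt_n1 r2_lt_n3 s1_le s2_le imax_ge1 outUV.
have [fU fV _ _] := admUV.
pose O := tangent_proj X2'' X3'' X1' X2'.
have pO QU QV : frame X1' QU -> frame X3''^T QV -> orthoproj (O QU QV).
  by move=> ? ?; apply: tangent_orthoproj.
have YtildeE : Ytilde = O (Pj U1) (Pj V3^T) Y.
  have t1 : W1 *L X2'' *R X3'' = Pperp X1' *L ract Y (rowH X2'' X3'').
    exact: row_term.
  have t2 : X1' *L X2' *R W3 = lact (colH X1' X2') (Y *R Pperp X3''^T).
    exact: col_term.
  have t3 : X1' *L W2 *R X3'' = Pj X1' *L (Y *R Pj X3''^T).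
    by rewrite /W2 contrLR contrLA contrRA /Pj trmxK contrLR.
  have t4 : U1 *L V2 *R X3'' = Pj U1 *L ract Y (rowG X2'' X3'').
    by rewrite /V2 contrLA -contrLR ract_rowG.
  have t5 : X1' *L U2 *R V3 = lact (colG X1' X2') (Y *R Pj V3^T).
    by rewrite /U2 contrLR -lact_colG contrRA lact_contrRC /Pj trmxK.
  have t6 : U1 *L Z2 *R V3 = Pj U1 *L (Y *R Pj V3^T).
    by rewrite /Z2 contrLR contrLA contrRA /Pj trmxK contrLR.
  rewrite /Ytilde t1 t2 t3 t4 t5 t6 /O /tangent_proj.
  by apply/ffunP => p; rewrite !tensorDE; ring.
split.
  have Cu := C_unit rankX ttdR ttdL orthX1'.
  have Du := D_unit rankX ttdR ttdL orthX3''.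
  have := ttd_tangent (W1 *m invmx (X1'^T *m X1)) W2 (invmx (X3 *m X3''^T) *m W3)
    U1 V3 U2 V2 Z2 (ttd_changeL ttdR ttdL orthX1').
  have -> : W1 *m invmx (X1'^T *m X1) *L (X1'^T *m X1 *L X2'') = W1 *L X2''.
    by rewrite contrLA mulmxKV.
  have -> : X1' *L (X1'^T *m X1 *L X2'') *R (invmx (X3 *m X3''^T) *m W3)
      = X1' *L X2' *R W3.
    rewrite (ttd_core ttdR ttdL orthX3'' orthX1') contrLR contrRA.
    by rewrite mulKVmx.
  by rewrite !subnKC.
move=> Yhat proj.
have le_dot := metric_projection_dot proj.
have [QU [QV [admQ fixQ]]] := tangent_cone_fixed rankX ttdR ttdL orthX2'' orthX3''
  orthX1' orthX2' (proj1 proj).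
have [fQU fQV _ _] := admQ.
have Yt2 : tdot Ytilde Ytilde = tdot Y Ytilde.
  by rewrite YtildeE (orthoproj_dot _ (pO _ _ fU fV)).
set a := fixedGain X2'' X3'' X1' X2' Y + gain X2'' X3'' X1' X2' Y QU QV.
have OY : tdot (O QU QV Y) (O QU QV Y) = a.
  by rewrite (orthoproj_dot _ (pO _ _ fQU fQV)) tangent_proj_dot.
have Yhat_le : tnorm Yhat ^+ 2 <= a.
  have [->|Yhat0] := eqVneq (tnorm Yhat) 0.
    by rewrite expr0n /= -OY tdot_ge0.
  have Yhat_gt0 : 0 < tnorm Yhat by rewrite lt_neqAle eq_sym Yhat0 tnorm_ge0.
  suff : tnorm Yhat <= tnorm (O QU QV Y).
    by rewrite -ler_sqr ?nnegrE ?tnorm_ge0 // [X in _ <= X]tnorm_sqr OY.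
  rewrite -(ler_pM2r Yhat_gt0) -expr2 tnorm_sqr (le_trans le_dot) //.
  by rewrite -[in leLHS]fixQ -(proj1 (pO _ _ fQU fQV)) cauchy_schwarz.
set w := Num.max c1 c2.
have [w_ge0 w_le1] : 0 <= w /\ w <= 1.
  have /andP[c1_ge0 c1_le1] : 0 <= c1 <= 1 by rewrite ratio01 ?subn_gt0.
  have /andP[c2_ge0 c2_le1] : 0 <= c2 <= 1 by rewrite ratio01 ?subn_gt0.
  by rewrite le_max c1_ge0 ge_max c1_le1 c2_le1.
have le_Ytilde : w * a <= tdot Ytilde Ytilde.
  rewrite Yt2 YtildeE tangent_proj_dot mulrDr lerD ?opt //.
  by rewrite ler_piMl // fixedGain_ge0.
rewrite -Yt2 -tnorm_sqr [X in _ <= X]expr2 ler_wpM2r ?tnorm_ge0 //.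
rewrite -ler_sqr ?nnegrE ?mulr_ge0 ?tnorm_ge0 ?sqrtr_ge0 // exprMn sqr_sqrtr //.
by rewrite (le_trans _ (_ : w * a <= _)) ?tnorm_sqr // -tnorm_sqr ler_wpM2l.
Qed.
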